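(* Let $\mathcal F$ and $\mathcal G$ be disjoint, cross-intersecting 3-graphs satisfying $\tau(\mathcal F)=\tau(\mathcal G)=3$. Then $$|\mathcal F|\,|\mathcal G|\le 100.$$ The bound is best possible: there exist disjoint, cross-intersecting 3-graphs $\mathcal F$ and $\mathcal G$ with $\tau(\mathcal F)=\tau(\mathcal G)=3$ and $|\mathcal F|\,|\mathcal G|=100$.
   Context: A 3-graph is a finite family (set) of 3-element sets, called its edges. The covering number $\tau(\mathcal F)$ is the minimum cardinality of a set meeting every member of $\mathcal F$. Two families $\mathcal F$ and $\mathcal G$ are cross-intersecting if $F\cap G\neq\varnothing$ for every $F\in\mathcal F$ and $G\in\mathcal G$. They are disjoint if $\mathcal F\cap\mathcal G=\varnothing$, i.e. they have no edge in common (their vertex supports may overlap). *)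

(* Defs.v *)
From mathcomp Require Import all_boot.

Set Implicit Arguments.
Unset Strict Implicit.
Unset Printing Implicit Defensive.

Section ThreeGraphs.

Variable T : finType.
Implicit Types (F G : {set {set T}}) (C : {set T}).

Definition is_3graph F : bool := [forall A in F, #|A| == 3].

Definition hitting_set F C : bool := [forall A in F, C :&: A != set0].

(* The default [set: T] hits every member of F unless set0 \in F; in that
   degenerate case F has no hitting set and the value is the junk #|T|. *)
Definition covering_number F : nat :=
  #|[arg min_(C < [set: T] | hitting_set F C) #|C|]|.

Definition cross_intersecting F G : bool :=
  [forall A in F, forall B in G, A :&: B != set0].

Lemma is_3graph_hitting_setT F : is_3graph F -> hitting_set F [set: T].
Proof.
move=> /forall_inP F3; apply/forall_inP => A /F3 /eqP A3.
by rewrite setTI -card_gt0 A3.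
Qed.

Lemma covering_numberP F (k : nat) : is_3graph F ->
  covering_number F = k <->
  (exists2 C, hitting_set F C & #|C| = k) /\
  (forall C, hitting_set F C -> k <= #|C|).
Proof.
move=> /is_3graph_hitting_setT FT; rewrite /covering_number.
case: arg_minnP => // C FC minC; split=> [<-|[[D FD <-] minD]].
  by split; [exists C | exact: minC].
by apply/eqP; rewrite eqn_leq minC ?minD.
Qed.

End ThreeGraphs.

(* Main.v *)
Require Import Defs.
From mathcomp Require Import all_boot zify.

(** Let [p x] and [q x] be the degrees of a vertex [x] in [F] and in [G].  The
    link of [x] in [G] is a graph [L] with [q x] edges, and the set [H] of edges
    of [F] avoiding [x] consists of 3-sets covering the edges of [L]; since
    [tau F = 3], no vertex lies in all of them, and since [tau G = 3], any two
    vertices lie in at most three of them.  If [q x >= 4], then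
    [|L| + |H| <= 10], apart from two configurations where the sum is 11.
    Adding this to the same bound with [F] and [G] exchanged, a vertex with
    [p x >= 4] and [q x >= 4] gives [|F| + |G| <= 20], hence [|F| |G| <= 100];
    the two exceptions are excluded separately, the first by disjointness.
    If there is no such vertex, [|F| <= |G|] and [|F| |G| > 100], then
    [|F| <= 9] and [p x <= 3] for all [x].  At a vertex with [|G| <= 3 q x], the
    edges of [G] avoiding [x] then cover a graph with two or three edges, and
    there are too few of them. *)

Set Implicit Arguments.
Unset Strict Implicit.
Unset Printing Implicit Defensive.

(** * Degrees, codegrees and sets of size 2 or 3 *)

Section Counting.

Variable T : finType.
Implicit Types (F G H L : {set {set T}}) (A B C D X e : {set T}).
Implicit Types (a b c s t u v w x y z : T).

(** The graph part rests on a rigidity: a cover avoiding a vertex [v] contains all neighbours of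
    [v], and some cover does avoid [v]. So degrees are at most 3, and a vertex of degree 3 is
    avoided by a single cover, its neighbourhood. Degree sums over one cover bound the number of
    edges; sorting the covers by the few vertices they contain or avoid bounds their number. The
    threshold 4 cannot be lowered: a matching of three edges can have eight covers, and 3 + 8 = 11.
    Vertices of degree at most 3 in one family therefore escape the sum bound and need the second
    half of the argument. There the codegree bound is a parameter [k], because the general value 3
    is too weak for larger families: it improves to 2 once [F] has at least six edges. A vertex with
    |G| <= 3 q x exists because the three vertices of one edge of [F] meet every edge of [G]. *)

Definition through F x := [set A in F | x \in A].
Definition missing F x := [set A in F | x \notin A].
Definition through2 F x y := [set A in F | (x \in A) && (y \in A)].

Definition avoid F x y := [set A in F | (x \notin A) && (y \notin A)].

Lemma card_through_missing F x : #|F| = #|through F x| + #|missing F x|.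
Proof.
rewrite -(cardsID [set A : {set T} | x \in A]).
by congr (_ + _); apply: eq_card => A; rewrite !inE // andbC.
Qed.

(** Inclusion-exclusion, kept additive because subtraction on [nat] truncates. *)
Lemma card_avoid F u v :
  #|F| + #|through2 F u v| = #|through F u| + #|through F v| + #|avoid F u v|.
Proof.
have := card_through_missing (through F v) u; have := card_through_missing (missing F u) v.
rewrite (card_through_missing F u).
have -> : through (through F v) u = through2 F u v.
  by apply/setP => A; rewrite !inE -andbA [(v \in A) && _]andbC.
have -> : missing (missing F u) v = avoid F u v by apply/setP => A; rewrite !inE andbA.
have -> : missing (through F v) u = through (missing F u) v.
  by apply/setP => A; rewrite !inE -!andbA [(v \in A) && _]andbC.
lia.
Qed.

Lemma through2C F x y : through2 F x y = through2 F y x.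
Proof. by apply/setP => A; rewrite !inE [(x \in A) && _]andbC. Qed.

Lemma through2S F G x y : F \subset G -> through2 F x y \subset through2 G x y.
Proof. by move=> /subsetP sFG; apply/subsetP => A; rewrite !inE => /andP[/sFG -> ->]. Qed.

Lemma card_set3 x y z : x != y -> x != z -> y != z -> #|[set x; y; z]| = 3.
Proof.
by move=> xy xz yz; rewrite setUC cardsU1 cards2 xy !inE negb_or ![z == _]eq_sym xz yz.
Qed.

Lemma mem_set3 w x y z : (w \in [set x; y; z]) = [|| w == x, w == y | w == z].
Proof. by rewrite !inE orbA. Qed.

Lemma set3_swap x y z : [set x; y; z] = [set x; z; y].
Proof. by apply/setP => w; rewrite !mem_set3 [(w == y) || _]orbC. Qed.

Lemma set3_rot x y z : [set x; y; z] = [set y; z; x].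
Proof. by apply/setP => w; rewrite !mem_set3 orbC orbA. Qed.

Lemma set3_eq C x y z : #|C| = 3 -> x \in C -> y \in C -> z \in C ->
  x != y -> x != z -> y != z -> C = [set x; y; z].
Proof.
move=> C3 xC yC zC xy xz yz; apply/esym/eqP; rewrite eqEcard C3 card_set3 // andbT.
by apply/subsetP => w; rewrite !inE => /orP[/orP[]|] /eqP ->.
Qed.

Lemma card2_other e s : #|e| = 2 -> s \in e -> exists2 t, s != t & e = [set s; t].
Proof.
move=> e2 se; have: #|e :\ s| = 1 by have := cardsD1 s e; rewrite se e2; lia.
move=> /eqP /cards1P[t et]; have : t \in e :\ s by rewrite et set11.
by rewrite !inE => /andP[ts _]; exists t; rewrite 1?eq_sym // -et setD1K.
Qed.

Lemma card3_others C x : #|C| = 3 -> x \in C ->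
  exists y z, [/\ x != y, x != z, y != z & C = [set x; y; z]].
Proof.
move=> C3 xC; have: #|C :\ x| == 2 by have := cardsD1 x C; rewrite xC C3; lia.
move=> /cards2P[y [z [yz Cyz]]]; exists y, z.
have : y \in C :\ x by rewrite Cyz !inE eqxx.
have : z \in C :\ x by rewrite Cyz !inE eqxx orbT.
rewrite !inE => /andP[zx zC] /andP[yx yC].
by rewrite ![x == _]eq_sym; split=> //; apply: set3_eq; rewrite // eq_sym.
Qed.

Lemma card3_third C x y : #|C| = 3 -> x \in C -> y \in C -> x != y ->
  exists z, [/\ x != z, y != z & C = [set x; y; z]].
Proof.
move=> C3 xC yC xy; have [a [b [xa xb ab CE]]] := card3_others C3 xC.
move: yC; rewrite CE !inE eq_sym (negbTE xy) /= => /orP[] /eqP ya; subst y.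
  by exists b.
by exists a; split=> //; [rewrite eq_sym | apply/setP => z; rewrite !inE orbAC].
Qed.

(** A 3-set through [u] and [v] is determined by its third vertex, which has to be the one in
    [X]. *)
Lemma card_through2_le H u v X : {in H, forall C, #|C| = 3} -> u != v ->
  u \notin X -> v \notin X ->
  (forall C, C \in H -> u \in C -> v \in C -> exists2 z, z \in X & z \in C) ->
  #|through2 H u v| <= #|X|.
Proof.
move=> H3 uv uX vX hit; apply: leq_trans (leq_imset_card (fun z => [set u; v; z]) X).
apply/subset_leq_card/subsetP => C; rewrite inE => /and3P[CH uC vC].
have [z zX zC] := hit C CH uC vC; apply/imsetP; exists z => //.
have uz : u != z by apply: contraNneq uX => ->.
have vz : v != z by apply: contraNneq vX => ->.
exact: set3_eq (H3 _ CH) _ _ _ _ _ _.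
Qed.

Lemma leq_card_imset2 (S1 S2 S : finType) (f : S1 -> S2 -> S) (X : {set S1}) (Y : {set S2}) :
  #|f @2: (X, Y)| <= #|X| * #|Y|.
Proof. by rewrite curry_imset2X -cardsX leq_imset_card. Qed.

End Counting.

(** * Graphs and the 3-sets covering their edges *)

Section GraphCover.

Variable T : finType.
Implicit Types (A B C D X e : {set T}).
Implicit Types (a b c s t u v w x y z : T).

Variables L H : {set {set T}}.
Hypothesis L2 : {in L, forall e, #|e| = 2}.
Hypothesis H3 : {in H, forall C, #|C| = 3}.
Hypothesis LH : forall e C, e \in L -> C \in H -> exists2 z, z \in e & z \in C.
Hypothesis Hmiss : forall v, exists2 C, C \in H & v \notin C.
Variable k : nat.
Hypothesis Hcod : forall u v, u != v -> #|through2 H u v| <= k.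

Definition nb v := [set w | [set v; w] \in L].

Lemma nb_neq u v : v \in nb u -> u != v.
Proof. by rewrite inE => /L2; rewrite cards2; case: eqVneq. Qed.

Lemma nb_sym u v : (v \in nb u) = (u \in nb v).
Proof. by rewrite !inE setUC. Qed.

Lemma edge_other e s : e \in L -> s \in e -> exists2 t, t \in nb s & e = [set s; t].
Proof. by move=> eL se; have [t st et] := card2_other (L2 eL) se; exists t; rewrite // inE -et. Qed.

Lemma edge_hit u v C : v \in nb u -> C \in H -> u \notin C -> v \in C.
Proof.
rewrite inE => uvL CH uC; have [z] := LH uvL CH.
by rewrite !inE => /orP[] /eqP -> //; rewrite (negbTE uC).
Qed.

Lemma nb_sub u C : C \in H -> u \notin C -> nb u \subset C.
Proof. by move=> CH uC; apply/subsetP => v vu; apply: edge_hit vu CH uC. Qed.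

Lemma card_nb_le3 u : #|nb u| <= 3.
Proof. by have [C CH uC] := Hmiss u; rewrite -(H3 CH) subset_leq_card ?nb_sub. Qed.

Lemma nb3_eq u C : #|nb u| = 3 -> C \in H -> u \notin C -> C = nb u.
Proof. by move=> d3 CH uC; apply/esym/eqP; rewrite eqEcard nb_sub // d3 (H3 CH). Qed.

Lemma nb3_in u : #|nb u| = 3 -> nb u \in H.
Proof. by move=> d3; have [C CH uC] := Hmiss u; rewrite -(nb3_eq d3 CH uC). Qed.

Lemma card_missing_nb3 u : #|nb u| = 3 -> #|missing H u| <= 1.
Proof.
move=> d3; rewrite -(cards1 (nb u)); apply/subset_leq_card/subsetP => C.
by rewrite inE in_set1 => /andP[CH uC]; rewrite (nb3_eq d3 CH uC).
Qed.

Lemma card_through_nb u : #|through L u| = #|nb u|.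
Proof.
have -> : through L u = [set [set u; w] | w in nb u].
  apply/setP => e; apply/idP/imsetP => [|[w]].
    by rewrite inE => /andP[eL ue]; have [t tu ->] := edge_other eL ue; exists t.
  by rewrite !inE => uw ->; rewrite uw !inE eqxx.
apply: card_in_imset => w w' /nb_neq uw _ /setP /(_ w).
by rewrite !inE eqxx orbT [w == u]eq_sym (negbTE uw) => /esym /eqP.
Qed.

Lemma card_edges_nb u : #|L| = #|nb u| + #|missing L u|.
Proof. by rewrite -card_through_nb -card_through_missing. Qed.

Lemma card_edges_avoid u v : u != v ->
  #|L| + (v \in nb u) = #|nb u| + #|nb v| + #|avoid L u v|.
Proof.
move=> uv; rewrite -!card_through_nb -card_avoid; congr (_ + _).
have sub e : e \in L -> u \in e -> v \in e -> e = [set u; v].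
  move=> eL ue ve; have [t _ eE] := edge_other eL ue; move: ve.
  by rewrite eE !inE eq_sym (negbTE uv) /= => /eqP ->.
have [uvL|uvL] := boolP (v \in nb u); apply/esym/eqP.
  apply/cards1P; exists [set u; v]; apply/setP => e; rewrite !inE.
  apply/and3P/eqP => [[eL ue ve]|->]; first exact: sub.
  by rewrite !inE !eqxx orbT; rewrite inE in uvL.
rewrite cards_eq0; apply/eqP/setP => e; rewrite !inE; apply/negP => /and3P[eL ue ve].
by rewrite inE -(sub e) ?eL in uvL.
Qed.

(** An edge avoiding [u] and [v] is covered by [w], so it is determined by a neighbour of [w] other
    than [u] and [v]. *)
Lemma card_avoid_le u v w : u != v -> u != w -> v != w -> [set u; v; w] \in H ->
  #|avoid L u v| + (w \in nb u) + (w \in nb v) <= #|nb w|.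
Proof.
move=> uv uw vw CH.
have : #|avoid L u v| <= #|(nb w :\ u) :\ v|.
  apply: leq_trans (leq_imset_card (fun t => [set w; t]) _).
  apply/subset_leq_card/subsetP => e; rewrite inE => /and3P[eL ue ve].
  have we : w \in e.
    by have [z ze] := LH eL CH; rewrite !inE => /orP[/orP[]|] /eqP zE; subst z; rewrite ?ze // in ue ve *.
  have [t tw eE] := edge_other eL we; apply/imsetP; exists t => //.
  rewrite !in_setD1 tw andbT.
  by apply/andP; split; [apply: contraNneq ve => <- | apply: contraNneq ue => <-]; rewrite eE !inE eqxx orbT.
rewrite (cardsD1 u (nb w)) (cardsD1 v (nb w :\ u)) in_setD1 eq_sym uv /=.
by rewrite (nb_sym u) (nb_sym v); lia.
Qed.

(** Every edge meets the cover, and those inside it are counted at both ends. When the degrees leave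
    no slack, the cover is thus independent. *)
Lemma card_edges_le u v w : u != v -> u != w -> v != w -> [set u; v; w] \in H ->
  #|L| + (v \in nb u) + (w \in nb u) + (w \in nb v) <= #|nb u| + #|nb v| + #|nb w|.
Proof. by move=> uv uw vw CH; have := card_avoid_le uv uw vw CH; have := card_edges_avoid uv; lia. Qed.

Lemma cover_set3 C : C \in H -> exists u v w, [/\ u != v, u != w, v != w & C = [set u; v; w]].
Proof.
move=> CH; have [x xC] : exists x, x \in C by apply/set0Pn; rewrite -card_gt0 (H3 CH).
by have [y [z [xy xz yz CE]]] := card3_others (H3 CH) xC; exists x, y, z.
Qed.

Lemma card_edges_le9 : L != set0 -> #|L| <= 9.
Proof.
case/set0Pn => e eL; have [x xe] : exists x, x \in e by apply/set0Pn; rewrite -card_gt0 (L2 eL).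
have [C CH _] := Hmiss x; have [u [v [w [uv uw vw CE]]]] := cover_set3 CH.
rewrite CE in CH; have := card_edges_le uv uw vw CH.
by have := card_nb_le3 u; have := card_nb_le3 v; have := card_nb_le3 w; clear; lia.
Qed.

Lemma card_covers_gt1 : L != set0 -> 1 < #|H|.
Proof.
case/set0Pn => e eL; have [x xe] : exists x, x \in e by apply/set0Pn; rewrite -card_gt0 (L2 eL).
have [C CH _] := Hmiss x.
have [y yC] : exists y, y \in C by apply/set0Pn; rewrite -card_gt0 (H3 CH).
have [D DH yD] := Hmiss y; apply/card_gt1P; exists C, D; split=> //.
by apply: contraNneq yD => <-.
Qed.

Lemma card_through2_edge u v e : u != v -> e \in L -> u \notin e -> v \notin e ->
  #|through2 H u v| <= 2.
Proof.
by move=> uv eL ue ve; rewrite -(L2 eL); apply: card_through2_le => // C CH _ _; apply: LH.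
Qed.

(** The third vertex of such a cover lies on both avoiding edges, and two distinct edges share at
    most one vertex. *)
Lemma card_through2_avoid u v : u != v -> 1 < #|avoid L u v| -> #|through2 H u v| <= 1.
Proof.
move=> uv /card_gt1P[e1 [e2 []]]; rewrite !inE => /and3P[e1L ue1 ve1] /and3P[e2L ue2 ve2] e12.
have : #|e1 :&: e2| <= 1.
  have e1D : #|e1 :&: e2| < #|e1|.
    rewrite proper_card // properEneq subsetIl andbT; apply: contra e12 => /eqP e1E.
    by rewrite eqEcard (L2 e1L) (L2 e2L) andbT -e1E subsetIr.
  by rewrite (L2 e1L) in e1D.
apply: leq_trans; apply: card_through2_le => //; rewrite ?inE ?negb_and ?ue1 ?ve1 //.
move=> C CH uC vC; have [z ze1 zC] := LH e1L CH; have [z' ze2 zC'] := LH e2L CH.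
exists z; rewrite // inE ze1; suff -> : z = z' by [].
have [w [uw vw CE]] := card3_third (H3 CH) uC vC uv.
have zw z0 e0 : u \notin e0 -> v \notin e0 -> z0 \in e0 -> z0 \in C -> z0 = w.
  move=> ue ve ze; rewrite CE !inE => /orP[/orP[]|] /eqP zE //; subst z0.
  - by rewrite ze in ue.
  - by rewrite ze in ve.
by rewrite (zw z e1) // (zw z' e2).
Qed.

(* Sets avoiding a vertex of degree 3 must equal its neighbourhood. *)
Lemma card_covers_two_nb3 u v : #|nb u| = 3 -> #|nb v| = 3 ->
  #|H| <= #|[set nb u; nb v]| + #|through2 H u v|.
Proof.
move=> du dv; apply: leq_trans (leq_card_setU _ _).
apply/subset_leq_card/subsetP => C CH; rewrite !inE CH /=.
have [uC|uC] := boolP (u \in C); last by rewrite -(nb3_eq du CH uC) eqxx.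
have [vC|vC] := boolP (v \in C); first by rewrite orbT.
by rewrite -(nb3_eq dv CH vC) eqxx orbT.
Qed.

(* The three edges missing [u] are covered by the two other vertices of [C], so
   one of these covers two of them. *)
Lemma nb2_outside u C : (forall v, v != u -> #|nb v| <= 2) -> #|L| = #|nb u| + 3 ->
  C \in H -> u \in C -> exists a, [/\ a \in C, a != u, a \notin nb u & #|nb a| = 2].
Proof.
move=> d2 Lu CH uC; have [a [b [ua ub ab CE]]] := card3_others (H3 CH) uC.
have := CH; rewrite CE => /(card_edges_le ua ub ab).
have /d2 da : a != u by rewrite eq_sym.
have /d2 db : b != u by rewrite eq_sym.
rewrite Lu => Lle; have [au|au] := boolP (a \in nb u).
  rewrite au in Lle; have bu : b \notin nb u.
    by apply/negP => bu; rewrite bu in Lle; move: Lle da db; clear; lia.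
  by exists b; rewrite mem_set3 eqxx !orbT eq_sym ub; split=> //; move: Lle da db; clear; lia.
have [bu|bu] := boolP (b \in nb u).
  rewrite bu in Lle; exists a; rewrite mem_set3 eqxx !orbT eq_sym ua; split=> //.
  by move: Lle da db; clear; lia.
have [a2|a2] := eqVneq #|nb a| 2; [exists a | exists b]; rewrite mem_set3 eqxx eq_sym !orbT //.
by split=> //; move: Lle da db a2; clear; lia.
Qed.

Lemma card_nb3_ge u v w x : u != v -> u != w -> v != w ->
  u \in nb x -> v \in nb x -> w \in nb x -> 2 < #|nb x|.
Proof.
move=> uv uw vw ux vx wx; rewrite -(card_set3 uv uw vw); apply/subset_leq_card/subsetP => z.
by rewrite in_setU in_set2 in_set1 => /orP[/orP[]|] /eqP ->.
Qed.

(** * Six or more edges, few vertices of degree 3 *)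

Lemma card_edges_covers_one_nb3 u : #|nb u| = 3 -> (forall v, v != u -> #|nb v| <= 2) ->
  5 < #|L| -> #|L| + #|H| <= 9.
Proof.
move=> du d2 L6; have nuH := nb3_in du.
(* The neighbours of [u] form a cover, and each has degree at most 2. *)
have L6E : #|L| = 6.
  have [a [b [c [ab ac bc nuE]]]] := cover_set3 nuH; have := nuH; rewrite nuE => /(card_edges_le ab ac bc).
  have d2n x : x \in nb u -> #|nb x| <= 2 by move=> /nb_neq xu; apply: d2; rewrite eq_sym.
  have := d2n a; have := d2n b; have := d2n c; rewrite nuE !in_setU !in_set1 !eqxx !orbT.
  by lia.
suff : #|through H u| <= 2.
  by rewrite (card_through_missing H u); have := card_missing_nb3 du; lia.
have [-> |[C]] := set_0Vmem (through H u); first by rewrite cards0.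
have Lu : #|L| = #|nb u| + 3 by rewrite du.
rewrite inE => /andP[CH uC]; have [a [aC au anu da]] := nb2_outside d2 Lu CH uC.
have sub b : b \notin nb u -> nb b \subset nb u by move=> bnu; apply: nb_sub.
(* Two such vertices have neighbourhoods of size 2 inside the 3-set [nb u], hence a common
   neighbour; being adjacent to [u] as well, it would have degree 3. So all covers through [u]
   contain [a]. *)
have uniq b : b != u -> b \notin nb u -> #|nb b| = 2 -> b = a.
  move=> bu bnu db; apply/eqP/negPn/negP => ba.
  have : 0 < #|nb a :&: nb b|.
    have : #|nb a :|: nb b| <= 3 by rewrite -du subset_leq_card // subUset !sub.
    by have := cardsUI (nb a) (nb b); rewrite da db; clear; lia.
  case/card_gt0P => x; rewrite in_setI => /andP[xa xb].
  have xu := subsetP (sub a anu) x xa; have := d2 x; rewrite eq_sym (nb_neq xu) => /(_ isT).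
  rewrite leqNgt => /negP[]; by apply: (card_nb3_ge bu ba); rewrite // 1?eq_sym // -nb_sym.
have ua : u != a by rewrite eq_sym.
have /card_gt0P[e] : 0 < #|avoid L u a| by have := card_edges_avoid ua; rewrite (negbTE anu); lia.
rewrite inE => /and3P[eL ue ae]; apply: leq_trans (card_through2_edge ua eL ue ae).
apply/subset_leq_card/subsetP => D; rewrite !inE => /andP[DH uD]; rewrite DH uD /=.
by have [b [bD bu bnu db]] := nb2_outside d2 Lu DH uD; rewrite -(uniq b bu bnu db).
Qed.

(** The degree count at a cover [C0] is tight: six edges, and [C0] is independent with all degrees
    2. A cover disjoint from [C0] must be the union [N] of the neighbourhoods, and at most one other
    cover meets [C0], so there are at most three covers. *)
Lemma card_edges_covers_nb2 : (forall v, #|nb v| <= 2) -> 5 < #|L| -> #|L| + #|H| <= 9.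
Proof.
move=> d2 L6; have L0 : L != set0 by rewrite -card_gt0; lia.
have /card_gt0P[C0 C0H] := ltnW (card_covers_gt1 L0).
have [a [b [c [ab ac bc C0E]]]] := cover_set3 C0H.
have := C0H; rewrite C0E => /(card_edges_le ab ac bc) Lle.
have [da db dc] : [/\ #|nb a| = 2, #|nb b| = 2 & #|nb c| = 2].
  by have := d2 a; have := d2 b; have := d2 c; move: Lle L6; clear; move=> *; split; lia.
have L6E : #|L| = 6 by move: Lle L6; rewrite da db dc; clear; lia.
have [nab nac nbc] : [/\ b \notin nb a, c \notin nb a & c \notin nb b].
  move: Lle; rewrite L6E da db dc.
  by case: (b \in nb a); case: (c \in nb a); case: (c \in nb b).
have dC x : x \in C0 -> #|nb x| = 2 by rewrite C0E !inE => /orP[/orP[]|] /eqP ->.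
have indep x y : x \in C0 -> y \in C0 -> y \notin nb x.
  have nn z : z \notin nb z by apply/negP => /nb_neq; rewrite eqxx.
  by rewrite C0E !mem_set3 => /or3P[] /eqP -> /or3P[] /eqP ->; rewrite // nb_sym.
have ne3 : nb a = nb b -> nb b = nb c -> False.
  move=> Eab Ebc; have [x xa] : exists x, x \in nb a by apply/card_gt0P; rewrite da.
  have := d2 x; rewrite leqNgt => /negP[].
  by apply: (card_nb3_ge ab ac bc); rewrite nb_sym -?Ebc -?Eab.
pose N := nb a :|: nb b :|: nb c.
have subN x : x \in C0 -> nb x \subset N.
  by rewrite C0E mem_set3 => /or3P[] /eqP ->; apply/subsetP => y yx; rewrite !in_setU yx ?orbT.
have [aC0 bC0 cC0] : [/\ a \in C0, b \in C0 & c \in C0] by rewrite C0E !mem_set3 !eqxx !orbT.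
have N3 : 2 < #|N|.
  rewrite ltnNge; apply/negP => N2.
  have nbN x : x \in C0 -> nb x = N.
    by move=> xC; apply/eqP; rewrite eqEcard (dC x xC) N2 subN.
  by apply: ne3; rewrite !nbN.
pose Tm := [set C in H | (C != C0) && (C :&: C0 != set0)].
(* One of [x], [y] is outside [C], so its two neighbours and [z] fill [C]; then the other is outside
   too and has the same neighbours. *)
have keyT C z x y : C \in H -> C != C0 -> z \in C -> C0 = [set z; x; y] -> z != x -> z != y ->
    x != y -> nb x = nb y /\ C = z |: nb x.
  have wlog_key x' y' : C \in H -> z \in C -> C0 = [set z; x'; y'] -> z != x' -> z != y' ->
      x' != y' -> x' \notin C -> nb x' = nb y' /\ C = z |: nb x'.
    move=> CH zC C0E' zx zy xy xC.
    have [zC0 xC0 yC0] : [/\ z \in C0, x' \in C0 & y' \in C0] by rewrite C0E' !inE !eqxx !orbT.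
    have CE' : C = z |: nb x'.
      apply/esym/eqP; rewrite eqEcard cardsU1 indep // dC // (H3 CH) andbT.
      by rewrite subUset sub1set zC nb_sub.
    have yC : y' \notin C by rewrite CE' in_setU1 negb_or eq_sym zy indep.
    split=> //; apply/esym/eqP; rewrite eqEcard !dC // leqnn andbT; apply/subsetP => w wy.
    have := subsetP (nb_sub CH yC) w wy; rewrite CE' in_setU1 => /orP[/eqP wz|//].
    by move: wy; rewrite wz (negbTE (indep _ _ yC0 zC0)).
  move=> CH CC0 zC C0E' zx zy xy.
  have [xC|xC] := boolP (x \in C); last exact: wlog_key.
  have yC : y \notin C.
    apply: contraNN CC0 => yC; rewrite C0E'; apply/eqP; exact: set3_eq (H3 CH) _ _ _ _ _ _.
  have yx : y != x by rewrite eq_sym.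
  have C0E2 : C0 = [set z; y; x] by rewrite C0E' set3_swap.
  have [nE CE'] := wlog_key y x CH zC C0E2 zy zx yx yC.
  by rewrite CE' nE.
have T1 : #|Tm| <= 1.
  have keyT' C : C \in Tm -> [\/ nb b = nb c /\ C = a |: nb b, nb c = nb a /\ C = b |: nb c
                               | nb a = nb b /\ C = c |: nb a].
    rewrite inE => /and3P[CH CC0 /set0Pn[z]]; rewrite in_setI C0E mem_set3.
    case/andP=> zC /or3P[] /eqP zE; subst z.
    - by constructor 1; apply: (keyT _ a b c).
    - by constructor 2; apply: (keyT _ b c a); rewrite // 1?eq_sym // C0E set3_rot.
    - by constructor 3; apply: (keyT _ c a b); rewrite // 1?eq_sym // C0E set3_rot set3_rot.
  apply/card_le1_eqP => C D /keyT' CE /keyT' DE.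
  by case: CE => -[e1 ->]; case: DE => -[e2 ->] //; case: ne3; congruence.
suff : #|H| <= #|[set C0; N]| + #|Tm|.
  by rewrite cards2 L6E => Hle; move: Hle T1; case: (C0 != N); clear; lia.
apply: leq_trans (leq_card_setU _ _); apply/subset_leq_card/subsetP => C CH.
rewrite !inE CH /=; case: eqVneq => //= CC0; case: (eqVneq (C :&: C0) set0) => CI; rewrite ?orbT //.
have CN x : x \in C0 -> nb x \subset C.
  by move=> xC0; apply: nb_sub => //; apply/negP => xC; move/setP/(_ x): CI; rewrite !inE xC xC0.
rewrite orbF eq_sym eqEcard (H3 CH) N3 andbT /N !subUset !CN // C0E !inE eqxx ?orbT //.
Qed.

(** Two vertices [u], [v] of degree 3 leave only the covers [nb u] and [nb v], as no cover contains
    both. With two covers at most, it is enough that the degrees over a cover sum to at most 3 + 2 +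
    2. *)
Lemma card_edges_covers_spread : 5 < #|L| ->
  (forall C u v, C \in H -> u \in C -> v \in C -> #|nb u| = 3 -> #|nb v| = 3 -> u = v) ->
  #|L| + #|H| <= 9.
Proof.
move=> L6 spread; case: (pickP [pred u | #|nb u| == 3]) => [u /eqP du|d2]; last first.
  by apply: card_edges_covers_nb2 => // v; have := card_nb_le3 v; have := d2 v => /= /eqP; lia.
have [H2|H2] := leqP #|H| 2.
  have [C CH _] := Hmiss u; have [a [b [c [ab ac bc CE]]]] := cover_set3 CH.
  have [aC bC cC] : [/\ a \in C, b \in C & c \in C] by rewrite CE !mem_set3 !eqxx !orbT.
  have ne x y : x \in C -> y \in C -> x != y -> #|nb x| + #|nb y| <= 5.
    move=> xC yC xy; have h : #|nb x| = 3 -> #|nb y| = 3 -> False.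
      by move=> dx dy; rewrite (spread C x y) ?eqxx in xy.
    by move: h (card_nb_le3 x) (card_nb_le3 y); clear; lia.
  have := ne a b aC bC ab; have := ne a c aC cC ac; have := ne b c bC cC bc.
  rewrite CE in CH; have := card_edges_le ab ac bc CH; have := card_nb_le3 a.
  have := card_nb_le3 b; have := card_nb_le3 c; move: H2; clear; lia.
apply: (card_edges_covers_one_nb3 du _ L6) => v vu; have [dv|dv] := eqVneq #|nb v| 3; last first.
  by have := card_nb_le3 v; rewrite leq_eqVlt (negbTE dv).
have := card_covers_two_nb3 du dv; rewrite cards2.
have [->|[C]] := set_0Vmem (through2 H u v); first by rewrite cards0; case: eqP; lia.
by rewrite inE => /and3P[CH uC vC]; rewrite (spread C u v) ?eqxx in vu.
Qed.

(** * Covers of two or three edges *)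

Lemma card_covers_two_edges : #|L| = 2 ->
  #|H| <= 4 * k \/ exists c, #|H| <= #|through H c| + k.
Proof.
move/eqP/cards2P => [e1 [e2 [e12 LE]]].
have [e1L e2L] : e1 \in L /\ e2 \in L by rewrite LE !inE !eqxx orbT.
have [I0|[c]] := set_0Vmem (e1 :&: e2).
  left; have /eqP/cards2P[a [b [ab e1E]]] := L2 e1L.
  have /eqP/cards2P[c [d [cd e2E]]] := L2 e2L.
  have ne x y : x \in e1 -> y \in e2 -> #|through2 H x y| <= k.
    move=> xe ye; apply: Hcod; apply/eqP => xy; move/setP/(_ x): I0.
    by rewrite !inE xe xy ye.
  apply: (@leq_trans #|(through2 H a c :|: through2 H a d) :|: (through2 H b c :|: through2 H b d)|).
    apply/subset_leq_card/subsetP => C CH; rewrite !inE CH /=.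
    have [x] := LH e1L CH; have [y] := LH e2L CH; rewrite e1E e2E !inE.
    by move=> /orP[] /eqP -> -> /orP[] /eqP -> ->; rewrite ?orbT.
  have -> : 4 * k = (k + k) + (k + k) by lia.
  have in2 : [/\ a \in e1, b \in e1, c \in e2 & d \in e2] by rewrite e1E e2E !inE !eqxx !orbT.
  case: in2 => ae be ce de.
  by do 2!(apply: leq_trans (leq_card_setU _ _) _; apply: leq_add);
     try (apply: leq_trans (leq_card_setU _ _) _; apply: leq_add); apply: ne.
rewrite inE => /andP[ce1 ce2]; right; exists c.
have [a ac e1E] := edge_other e1L ce1; have [b bc e2E] := edge_other e2L ce2.
have ab : a != b by apply: contraNneq e12 => ab; rewrite e1E e2E ab.
rewrite (card_through_missing H c) leq_add2l; apply: leq_trans (Hcod ab).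
apply/subset_leq_card/subsetP => C; rewrite !inE => /andP[CH cC].
by rewrite CH (edge_hit ac CH cC) (edge_hit bc CH cC).
Qed.

Lemma card_covers_matching e1 e2 e3 : e1 \in L -> e2 \in L -> e3 \in L ->
  [disjoint e1 & e2] -> [disjoint e1 & e3] -> [disjoint e2 & e3] ->
  #|H| <= 8 /\ (8 <= #|H| -> forall x y z, x \in e1 -> y \in e2 -> z \in e3 -> [set x; y; z] \in H).
Proof.
move=> e1L e2L e3L d12 d13 d23.
pose f (p : T * T * T) := [set p.1.1; p.1.2; p.2].
pose I := f @: setX (setX e1 e2) e3.
have I8 : #|I| <= 8.
  by apply: leq_trans (leq_imset_card _ _) _; rewrite !cardsX (L2 e1L) (L2 e2L) (L2 e3L).
have ne (e e' : {set T}) x y : [disjoint e & e'] -> x \in e -> y \in e' -> x != y.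
  by move=> dee xe ye; apply: contraTneq xe => ->; rewrite (disjointFl dee).
have HI : H \subset I.
  apply/subsetP => C CH; have [x xe xC] := LH e1L CH; have [y ye yC] := LH e2L CH.
  have [z ze zC] := LH e3L CH; apply/imsetP; exists (x, y, z); first by rewrite !inE xe ye.
  by rewrite /f /=; apply: set3_eq (H3 CH) xC yC zC (ne _ _ _ _ d12 xe ye) (ne _ _ _ _ d13 xe ze)
    (ne _ _ _ _ d23 ye ze).
split=> [|H8 x y z xe ye ze]; first exact: leq_trans (subset_leq_card HI) I8.
have /eqP -> : H == I by rewrite eqEcard HI (leq_trans I8).
by apply/imsetP; exists (x, y, z); rewrite // !inE xe ye.
Qed.

(** A cover missing [c] contains the other ends [a] and [b] of [e1] and [e2]. The three outcomes
    correspond to [e3] passing through [c], being disjoint from the cherry, and meeting it only in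
    [a] or [b]. *)
Lemma card_covers_cherry c e1 e2 e3 : e1 \in L -> e2 \in L -> e3 \in L ->
  e1 != e2 -> e3 != e1 -> e3 != e2 -> c \in e1 -> c \in e2 ->
  [\/ #|H| <= #|through H c| + 1, #|H| <= 2 * k + 2
    | exists x y, y \in nb x /\ #|H| <= #|through2 H x y| + 2 * k].
Proof.
move=> e1L e2L e3L e12 e31 e32 ce1 ce2.
have [a ac e1E] := edge_other e1L ce1; have [b bc e2E] := edge_other e2L ce2.
have ab : a != b by apply: contraNneq e12 => ab; rewrite e1E e2E ab.
have mc : missing H c \subset through2 H a b.
  apply/subsetP => C; rewrite !inE => /andP[CH cC].
  by rewrite CH (edge_hit ac CH cC) (edge_hit bc CH cC).
have [ce3|ce3] := boolP (c \in e3).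
  constructor 1; rewrite (card_through_missing H c) leq_add2l card_missing_nb3 //.
  have [d dc e3E] := edge_other e3L ce3; apply/eqP; rewrite eqn_leq card_nb_le3 /=.
  have ad : a != d by apply: contraNneq e31 => ad; rewrite e3E e1E ad.
  have bd : b != d by apply: contraNneq e32 => bd; rewrite e3E e2E bd.
  exact: card_nb3_ge ab ad bd ac bc dc.
have key x y : e3 = [set x; y] -> #|through H c| <= #|through2 H c x| + k.
  move=> e3E; have cy : c != y by apply: contraNneq ce3 => ->; rewrite e3E !inE eqxx orbT.
  apply: leq_trans (leq_add (leqnn _) (Hcod cy)); apply: leq_trans (leq_card_setU _ _).
  apply/subset_leq_card/subsetP => C; rewrite !inE => /andP[CH cC]; rewrite CH cC /=.
  by have [z] := LH e3L CH; rewrite e3E !inE => /orP[] /eqP -> ->; rewrite ?orbT.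
have mck := leq_trans (subset_leq_card mc) (Hcod ab); rewrite (card_through_missing H c).
have [ae3|ae3] := boolP (a \in e3).
  have [d _ e3E] := edge_other e3L ae3; constructor 3; exists c, a; split=> //.
  by apply: leq_trans (leq_add (key _ _ e3E) mck) _; rewrite mul2n -addnn addnA.
have [be3|be3] := boolP (b \in e3).
  have [d _ e3E] := edge_other e3L be3; constructor 3; exists c, b; split=> //.
  by apply: leq_trans (leq_add (key _ _ e3E) mck) _; rewrite mul2n -addnn addnA.
constructor 2; have /eqP/cards2P[x [y [xy e3E]]] := L2 e3L.
have cx : c != x by apply: contraNneq ce3 => ->; rewrite e3E !inE eqxx.
apply: leq_add; last exact: leq_trans (subset_leq_card mc) (card_through2_edge ab e3L ae3 be3).
by apply: leq_trans (key _ _ e3E) _; rewrite mul2n -addnn leq_add2r Hcod.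
Qed.

Lemma card_covers_three_edges : #|L| = 3 ->
  [\/ exists e1 e2 e3, [/\ L = [set e1; e2; e3], [disjoint e1 & e2], [disjoint e1 & e3]
        & [disjoint e2 & e3]],
      exists c, #|H| <= #|through H c| + 1, #|H| <= 2 * k + 2
    | exists x y, y \in nb x /\ #|H| <= #|through2 H x y| + 2 * k].
Proof.
move=> L3; have /card_gt0P[e1 e1L'] : 0 < #|L| by rewrite L3.
have [e2 [e3 [e12 e13 e23 LE]]] := card3_others L3 e1L'.
have [e1L e2L e3L] : [/\ e1 \in L, e2 \in L & e3 \in L] by rewrite LE !mem_set3 !eqxx !orbT.
have cherry c f1 f2 f3 : f1 \in L -> f2 \in L -> f3 \in L -> f1 != f2 -> f3 != f1 -> f3 != f2 ->
    c \in f1 :&: f2 ->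
    [\/ exists e1 e2 e3, [/\ L = [set e1; e2; e3], [disjoint e1 & e2], [disjoint e1 & e3]
          & [disjoint e2 & e3]],
        exists c, #|H| <= #|through H c| + 1, #|H| <= 2 * k + 2
      | exists x y, y \in nb x /\ #|H| <= #|through2 H x y| + 2 * k].
  move=> f1L f2L f3L f12 f31 f32; rewrite in_setI => /andP[cf1 cf2].
  case: (card_covers_cherry f1L f2L f3L f12 f31 f32 cf1 cf2) => h.
  - by constructor 2; exists c.
  - by constructor 3.
  - by constructor 4.
have [I12|[c]] := set_0Vmem (e1 :&: e2); last by apply: cherry e3L _ _ _; rewrite // eq_sym.
have [I13|[c]] := set_0Vmem (e1 :&: e3); last by apply: cherry e2L _ _ _; rewrite // eq_sym.
have [I23|[c]] := set_0Vmem (e2 :&: e3); last by apply: cherry e1L _ _ _; rewrite // eq_sym.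
by constructor 1; exists e1, e2, e3; rewrite -!setI_eq0 I12 I13 I23 eqxx.
Qed.

(** * Four or more edges *)

Hypothesis k3 : k <= 3.

Lemma card_through2_le3 u v : u != v -> #|through2 H u v| <= 3.
Proof. by move=> uv; apply: leq_trans (Hcod uv) k3. Qed.

Lemma card_through2_avoid_le u v : u != v ->
  #|through2 H u v| <= if 1 < #|avoid L u v| then 1 else if 0 < #|avoid L u v| then 2 else 3.
Proof.
move=> uv; case: ifPn => [|_]; first exact: card_through2_avoid.
case: ifPn => [/card_gt0P[e]|_]; last exact: card_through2_le3.
by rewrite inE => /and3P[eL ue ve]; apply: card_through2_edge eL ue ve.
Qed.

(** The cover [nb u] avoids [v], so it equals [nb v]: only one cover fails to contain both [u] and
    [v]. The edges avoiding both number |L| - 6, which limits the codegree. *)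
Lemma card_covers_nonadj u v : u != v -> #|nb u| = 3 -> #|nb v| = 3 -> v \notin nb u ->
  #|H| <= if 7 < #|L| then 2 else if 6 < #|L| then 3 else 4.
Proof.
move=> uv du dv uvL; have := card_covers_two_nb3 du dv.
have -> : nb u = nb v by apply: nb3_eq (nb3_in du) uvL.
have := card_edges_avoid uv; rewrite (negbTE uvL) du dv addn0 setUid cards1 => ->.
move=> Hle; apply: leq_trans Hle _; have := card_through2_avoid_le uv.
by clear; do !case: ifP; lia.
Qed.

Lemma card_edges_covers_two_nb3 u v : u != v -> #|nb u| = 3 -> #|nb v| = 3 ->
  #|L| + #|H| <= 10 \/ #|L| = 9 /\ #|H| = 2.
Proof.
move=> uv du dv; have L0 : L != set0 by rewrite -card_gt0 (card_edges_nb u) du.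
have L9 := card_edges_le9 L0; have H1 := card_covers_gt1 L0.
suff : #|H| <= if 7 < #|L| then 2 else if 6 < #|L| then 3 else if 5 < #|L| then 4 else 5.
  by do !case: ifP; lia.
have Luv := card_edges_avoid uv; rewrite du dv in Luv.
have [uvL|uvL] := boolP (v \in nb u); last first.
  by apply: leq_trans (card_covers_nonadj uv du dv uvL) _; do !case: ifP; lia.
have Huv := card_covers_two_nb3 du dv; have := leq_ltn_trans Huv; rewrite cards2 in Huv.
have R := card_through2_avoid_le uv; rewrite uvL in Luv.
have [L7|L8] := leqP #|L| 7.
  have {}Huv : #|H| <= 2 + #|through2 H u v| by case: eqP Huv; lia.
  move=> _; apply: leq_trans Huv _; move: R Luv; do !case: ifP; lia.
(* Now at least three edges avoid [u] and [v]. In a cover with third vertex [w] they all lie at [w],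
   so [w] has degree 3 and is not adjacent to [u], and the non-adjacent case applies to [u] and
   [w]. *)
move=> _; have [H0|] := set_0Vmem (through2 H u v).
  by rewrite H0 cards0 addn0 in Huv; case: eqP Huv; lia.
case=> C; rewrite inE => /and3P[CH uC vC].
have [w [uw vw CE]] := card3_third (H3 CH) uC vC uv; rewrite CE in CH.
have Rw := card_avoid_le uv uw vw CH; have dw := card_nb_le3 w.
suff : #|H| <= if 7 < #|L| then 2 else if 6 < #|L| then 3 else 4 by rewrite L8.
apply: (@card_covers_nonadj u w) => //; first by move: Rw dw Luv L8; clear; lia.
by apply/negP => wu; rewrite wu in Rw; move: Rw dw Luv L8; clear; lia.
Qed.

(** The degree count is tight at a cover [C]: it is independent with all degrees 3. Each
    neighbourhood is then a cover other than [C], and there is only one: the graph is complete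
    bipartite. *)
Lemma nine_edges_bipartite : #|L| = 9 -> exists C D,
  [/\ C \in H, D \in H, [disjoint C & D], #|H| = 2 & forall c d, c \in C -> d \in D -> d \in nb c].
Proof.
move=> L9; have L0 : L != set0 by rewrite -card_gt0 L9.
have /card_gt0P[C CH] := ltnW (card_covers_gt1 L0).
have [u [v [w [uv uw vw CE]]]] := cover_set3 CH; have := CH; rewrite CE => /(card_edges_le uv uw vw).
have du := card_nb_le3 u; have dv := card_nb_le3 v; have dw := card_nb_le3 w => Lle.
have [{}du {}dv {}dw] : [/\ #|nb u| = 3, #|nb v| = 3 & #|nb w| = 3].
  by move: Lle du dv dw; rewrite L9; clear; move=> *; split; lia.
have H2 : #|H| = 2.
  have := card_covers_gt1 L0; suff : #|H| <= 2 by lia.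
  have := card_covers_nonadj uv du dv; rewrite L9; apply; apply/negP => vu; rewrite vu in Lle.
  by move: Lle; rewrite L9 du dv dw; clear; lia.
have dC c : c \in C -> #|nb c| = 3 by rewrite CE !inE => /orP[/orP[]|] /eqP ->.
have uC : u \in C by rewrite CE !inE eqxx.
have nbC c : c \in C -> nb c != C.
  by move=> cC; apply: contraTneq cC => <-; apply/negP => /nb_neq; rewrite eqxx.
have HE : H = [set C; nb u].
  apply/esym/eqP; rewrite eqEcard H2 cards2 eq_sym nbC // andbT.
  by apply/subsetP => D; rewrite !inE => /orP[] /eqP -> //; apply: nb3_in.
have nbE c : c \in C -> nb c = nb u.
  move=> cC; have := nb3_in (dC c cC).
  by rewrite HE !inE (negbTE (nbC c cC)) /= => /eqP.
exists C, (nb u); split=> //; first exact: nb3_in.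
  rewrite disjoint_subset; apply/subsetP => c cC; rewrite inE /= -(nbE c cC).
  by apply/negP => /nb_neq; rewrite eqxx.
by move=> c d /nbE ->.
Qed.

(** Disjoint edges leave 2 * 2 choices for the two further vertices. If they share [y], at most
    three covers use [y], and one uses both other ends. *)
Lemma card_through_two_edges u e1 e2 : e1 \in L -> e2 \in L -> e1 != e2 ->
  u \notin e1 -> u \notin e2 -> #|through H u| <= 4.
Proof.
move=> e1L e2L e12 ue1 ue2.
have ne z e : u \notin e -> z \in e -> u != z by move=> ue ze; apply: contraNneq ue => ->.
have [I0|[y]] := set_0Vmem (e1 :&: e2).
  apply: (@leq_trans #|(fun s t => [set u; s; t]) @2: (e1, e2)|); last first.
    by apply: leq_trans (leq_card_imset2 _ _ _) _; rewrite (L2 e1L) (L2 e2L).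
  apply/subset_leq_card/subsetP => C; rewrite inE => /andP[CH uC].
  have [s se1 sC] := LH e1L CH; have [t te2 tC] := LH e2L CH.
  apply/imset2P; exists s t => //; apply: set3_eq; rewrite ?(H3 CH) ?(ne s e1) ?(ne t e2) //.
  by apply/eqP => st; move/setP/(_ s): I0; rewrite !inE se1 st te2.
rewrite in_setI => /andP[ye1 ye2].
have [a ay e1E] := edge_other e1L ye1; have [b yb e2E] := edge_other e2L ye2.
have uy := ne y e1 ue1 ye1.
apply: (@leq_trans #|through2 H u y :|: [set [set u; a; b]]|); last first.
  by apply: leq_trans (leq_card_setU _ _) _; rewrite cards1 addn1 ltnS card_through2_le3.
apply/subset_leq_card/subsetP => C; rewrite !inE => /andP[CH uC]; rewrite CH uC /=.
have [yC//|yC /=] := boolP (y \in C); apply/eqP.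
apply: set3_eq; rewrite ?(H3 CH) ?(ne a e1) ?(ne b e2) //.
- by apply: edge_hit CH yC.
- by apply: edge_hit CH yC.
- by rewrite e1E !inE eqxx orbT.
- by rewrite e2E !inE eqxx orbT.
- by apply: contra e12 => /eqP ab; rewrite e1E e2E ab.
Qed.

Lemma missing_through2 u s t : nb u = [set s; t] -> missing H u \subset through2 H s t.
Proof.
move=> nuE; apply/subsetP => C; rewrite !inE => /andP[CH uC]; rewrite CH /=.
by have /subsetP sub := nb_sub CH uC; rewrite !sub // nuE !inE eqxx ?orbT.
Qed.

Lemma card_covers_five_edges : #|L| = 5 -> #|H| <= 5.
Proof.
move=> L5; case: (pickP [pred u | #|nb u| == 3]) => [u /eqP du|d3].
  rewrite (card_through_missing H u) -[5]/(4 + 1) leq_add ?card_missing_nb3 //.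
  have : 1 < #|missing L u| by have := card_edges_nb u; rewrite L5 du; lia.
  case/card_gt1P => e1 [e2 []]; rewrite !inE => /andP[e1L ue1] /andP[e2L ue2] e12.
  exact: card_through_two_edges e1L e2L e12 ue1 ue2.
have d2 v : #|nb v| <= 2 by have := card_nb_le3 v; have := d3 v => /= /eqP; lia.
have L0 : L != set0 by rewrite -card_gt0 L5.
have [u du] : exists u, #|nb u| = 2.
  have /card_gt0P[C CH] := ltnW (card_covers_gt1 L0); have [a [b [c [ab ac bc CE]]]] := cover_set3 CH.
  rewrite CE in CH; have := card_edges_le ab ac bc CH; rewrite L5.
  case: (eqVneq #|nb a| 2) => [|na]; first by exists a.
  case: (eqVneq #|nb b| 2) => [|nb]; first by exists b.
  by exists c; have := d2 a; have := d2 b; have := d2 c; lia.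
have /eqP/cards2P[s [t [st nuE]]] := du.
have mst := subset_leq_card (missing_through2 nuE).
rewrite (card_through_missing H u).
have [->|[C]] := set_0Vmem (through H u).
  by rewrite cards0 add0n (leq_trans mst) // (leq_trans (card_through2_le3 st)).
rewrite inE => /andP[CH uC].
have [|a [aC au anu da]] := nb2_outside (fun v _ => d2 v) _ CH uC; first by rewrite L5 du.
have ua : u != a by rewrite eq_sym.
have : #|avoid L u a| == 1 by have := card_edges_avoid ua; rewrite (negbTE anu) L5 du da; lia.
case/cards1P => e eE; have : e \in avoid L u a by rewrite eE set11.
rewrite inE => /and3P[eL ue ae].
(* Covers through [u] plus covers missing it: 2 + 3 if [e] is disjoint from [nb a], since then all
   covers through [u] contain [a]; otherwise 3 + 2, since the edge from [a] to [b] then avoids both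
   neighbours of [u]. *)
have [nbe|[b]] := set_0Vmem (e :&: nb a).
  rewrite -[5]/(2 + 3) leq_add //; last by apply: leq_trans mst (card_through2_le3 st).
  apply: leq_trans (card_through2_edge ua eL ue ae).
  apply/subset_leq_card/subsetP => D; rewrite !inE => /andP[DH uD]; rewrite DH uD /=.
  apply/negPn/negP => aD; have DE : D = u |: nb a.
    apply/esym/eqP; rewrite eqEcard cardsU1 nb_sym anu da (H3 DH) andbT.
    by rewrite subUset sub1set uD nb_sub.
  have [z ze] := LH eL DH; rewrite DE in_setU1 => /orP[/eqP zu|zna]; first by rewrite zu (negbTE ue) in ze.
  by move/setP/(_ z): nbe; rewrite in_setI ze zna inE.
rewrite in_setI => /andP[be ba]; have [c cb eE'] := edge_other eL be.
rewrite -[5]/(3 + 2) leq_add //.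
  apply: (@leq_trans #|through2 H u a :|: [set u |: nb a]|).
    apply/subset_leq_card/subsetP => D; rewrite !inE => /andP[DH uD]; rewrite DH uD /=.
    have [//|aD] := boolP (a \in D); rewrite orFb eq_sym eqEcard cardsU1 nb_sym anu da (H3 DH) andbT.
    by rewrite subUset sub1set uD nb_sub.
  apply: leq_trans (leq_card_setU _ _) _; rewrite cards1 addn1 ltnS.
  exact: card_through2_edge ua eL ue ae.
apply: leq_trans mst _; have abL : [set a; b] \in L by move: ba; rewrite inE.
have nuab x : x \in nb u -> x \notin [set a; b].
  move=> xu; rewrite !inE negb_or; apply/andP; split; first by apply: contraNneq anu => <-.
  apply/eqP => xb; subst x; have := d2 b; rewrite leqNgt => /negP[].
  have uc : u != c by apply: contraNneq ue => ->; rewrite eE' !inE eqxx orbT.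
  have ac : a != c by apply: contraNneq ae => ->; rewrite eE' !inE eqxx orbT.
  by apply: (card_nb3_ge ua uc ac); rewrite // nb_sym.
by apply: card_through2_edge st abL _ _; apply: nuab; rewrite nuE !inE eqxx ?orbT.
Qed.

(* The configuration with 4 edges and 7 covers: the edges are [st] and the three
   edges at [u], and the covers are [nb u], three sets through [u] and [s], and
   three sets through [u] and [t]. *)
Definition exceptional := exists u s t,
  [/\ #|nb u| = 3, s != t, u \notin [set s; t] & [set s; t] \in L] /\
  [/\ #|through H u| = 6, #|through2 H u s| = 3, #|through2 H u t| = 3 &
      forall C, C \in H -> u \in C -> s \in C -> t \in C -> False].

Lemma card_covers_four_edges : #|L| = 4 -> #|H| <= 6 \/ #|H| = 7 /\ exceptional.
Proof.
move=> L4; case: (pickP [pred u | #|nb u| == 3]) => [u /eqP du|d3].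
  have : #|missing L u| == 1 by have := card_edges_nb u; rewrite L4 du; lia.
  case/cards1P => e eE; have : e \in missing L u by rewrite eE set11.
  rewrite inE => /andP[eL ue]; have /eqP/cards2P[s [t [st est]]] := L2 eL; rewrite est in eL ue.
  have [us ut] : u != s /\ u != t by move: ue; rewrite !inE negb_or => /andP[].
  have sub : through H u \subset through2 H u s :|: through2 H u t.
    apply/subsetP => C; rewrite !inE => /andP[CH uC]; rewrite CH uC /=.
    by have [z] := LH eL CH; rewrite !inE => /orP[] /eqP -> ->; rewrite ?orbT.
  have {sub}:= subset_leq_card sub; rewrite cardsU => sub.
  have ms := card_missing_nb3 du; have cs := card_through2_le3 us; have ct := card_through2_le3 ut.
  have cH := card_through_missing H u.
  have [|H7] := leqP #|H| 6; [by left | right].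
  have [I0|[C CI]] := set_0Vmem (through2 H u s :&: through2 H u t).
    rewrite I0 cards0 in sub; split; first by move: sub ms cs ct cH H7; clear; lia.
    exists u, s, t; split=> //; split; try by move: sub ms cs ct cH H7; clear; lia.
    by move=> C CH uC sC tC; move/setP/(_ C): I0; rewrite !inE CH uC sC tC.
  have : 0 < #|through2 H u s :&: through2 H u t| by apply/card_gt0P; exists C.
  by move: sub ms cs ct cH H7; clear; lia.
left; have d2 v : #|nb v| <= 2 by have := card_nb_le3 v; have := d3 v => /= /eqP; lia.
have L0 : L != set0 by rewrite -card_gt0 L4.
have [u du] : exists u, #|nb u| = 2.
  have /card_gt0P[C CH] := ltnW (card_covers_gt1 L0); have [a [b [c [ab ac bc CE]]]] := cover_set3 CH.
  rewrite CE in CH; have := card_edges_le ab ac bc CH; rewrite L4.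
  case: (eqVneq #|nb a| 2) => [|na]; first by exists a.
  case: (eqVneq #|nb b| 2) => [|nb]; first by exists b.
  by exists c; have := d2 a; have := d2 b; have := d2 c; lia.
have /eqP/cards2P[s [t [st nuE]]] := du.
have : 1 < #|missing L u| by have := card_edges_nb u; rewrite L4 du; lia.
case/card_gt1P => e1 [e2 []]; rewrite !inE => /andP[e1L ue1] /andP[e2L ue2] e12.
pose W := [set C in through H u | ~~ ((s \in C) && (t \in C))].
have HW : #|H| <= #|through2 H s t| + #|W|.
  apply: leq_trans (leq_card_setU _ _); apply/subset_leq_card/subsetP => C CH.
  have [uC|uC] := boolP (u \in C).
    by rewrite !inE CH uC /=; case: ((s \in C) && (t \in C)).
  by rewrite inE; have /subsetP -> // := missing_through2 nuE; rewrite inE CH.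
have W4 : #|W| <= 4.
  apply: leq_trans (card_through_two_edges e1L e2L e12 ue1 ue2).
  by apply/subset_leq_card/subsetP => C; rewrite inE => /andP[].
have [st2|st3] := leqP #|through2 H s t| 2.
  by apply: leq_trans HW _; rewrite -[6]/(2 + 4) leq_add.
(* Three covers through [s] and [t] leave no edge avoiding both. With degrees at most 2, the graph
   is the path [y1], [s], [u], [t], [y2], or a 4-cycle if [y1 = y2]. *)
have meet e : e \in L -> (s \in e) || (t \in e).
  move=> eL; apply/negPn/negP; rewrite negb_or => /andP[se te].
  by have := card_through2_edge st eL se te; rewrite leqNgt st3.
have [su tu] : u \in nb s /\ u \in nb t by rewrite !(nb_sym _ u) nuE !inE !eqxx orbT.
have once v e e' : u \in nb v -> e \in L -> e' \in L -> u \notin e -> u \notin e' -> e != e' ->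
    v \in e -> v \in e' -> False.
  move=> uv eL e'L ue ue' ee' ve ve'; have := d2 v; rewrite leqNgt => /negP[].
  have [y yv eE] := edge_other eL ve; have [y' y'v eE'] := edge_other e'L ve'.
  apply: (card_nb3_ge _ _ _ uv yv y'v).
  - by apply: contraNneq ue => ->; rewrite eE !inE eqxx orbT.
  - by apply: contraNneq ue' => ->; rewrite eE' !inE eqxx orbT.
  - by apply: contraNneq ee' => yy; rewrite eE eE' yy.
have [f1 [f2 [[f1L uf1 sf1 tf1] [f2L uf2 tf2 sf2]]]] : exists f1 f2,
    [/\ f1 \in L, u \notin f1, s \in f1 & t \notin f1] /\
    [/\ f2 \in L, u \notin f2, t \in f2 & s \notin f2].
  have [se1|se1] := boolP (s \in e1).
    have se2 : s \notin e2 by apply/negP => se2; apply: (once s e1 e2).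
    have te2 : t \in e2 by have := meet e2 e2L; rewrite (negbTE se2).
    by exists e1, e2; split; split=> //; apply/negP => te1; apply: (once t e1 e2).
  have te1 : t \in e1 by have := meet e1 e1L; rewrite (negbTE se1).
  have te2 : t \notin e2 by apply/negP => te2; apply: (once t e1 e2).
  have se2 : s \in e2 by have := meet e2 e2L; rewrite (negbTE te2) orbF.
  by exists e2, e1.
have ne z (f : {set T}) : u \notin f -> z \in f -> u != z.
  by move=> uf zf; apply: contraNneq uf => ->.
have [y1 y1s f1E] := edge_other f1L sf1; have [y2 y2t f2E] := edge_other f2L tf2.
have [y1f y2f] : y1 \in f1 /\ y2 \in f2 by rewrite f1E f2E !inE !eqxx !orbT.
have [us ut uy1 uy2] : [/\ u != s, u != t, u != y1 & u != y2].
  by rewrite (ne s f1) ?(ne t f2) ?(ne y1 f1) ?(ne y2 f2).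
have sy2 : s != y2 by apply: contraNneq sf2 => ->.
have y1t : y1 != t by apply: contraNneq tf1 => <-.
apply: leq_trans HW _; rewrite -[6]/(3 + 3) leq_add ?card_through2_le3 //.
have [yy|yy] := eqVneq y1 y2.
  subst y2; apply: leq_trans (card_through2_le3 uy1).
  apply/subset_leq_card/subsetP => C; rewrite !inE => /andP[/andP[CH uC]]; rewrite CH uC /=.
  by case/nandP => [sC|tC]; [apply: edge_hit y1s CH sC | apply: edge_hit y2t CH tC].
apply: (@leq_trans #|[set [set u; s; y2]; [set u; y1; t]; [set u; y1; y2]]|); last first.
  apply: leq_trans (leq_card_setU _ _) _; rewrite cards1 cards2.
  by case: (_ != _).
apply/subset_leq_card/subsetP => C; rewrite mem_set3 !inE => /andP[/andP[CH uC]] nst.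
have [sC|sC] := boolP (s \in C).
  have tC : t \notin C by rewrite sC in nst.
  by rewrite -(set3_eq (H3 CH) uC sC (edge_hit y2t CH tC)) ?eqxx.
have y1C := edge_hit y1s CH sC.
have [tC|tC] := boolP (t \in C).
  by rewrite -(set3_eq (H3 CH) uC y1C tC) ?eqxx ?orbT.
by rewrite -(set3_eq (H3 CH) uC y1C (edge_hit y2t CH tC)) ?eqxx ?orbT.
Qed.

Lemma card_edges_covers : 3 < #|L| ->
  [\/ #|L| + #|H| <= 10, #|L| = 9 /\ #|H| = 2 | [/\ #|L| = 4, #|H| = 7 & exceptional]].
Proof.
rewrite leq_eqVlt => /orP[/eqP/esym L4|].
  case: (card_covers_four_edges L4) => [H6|[H7 exc]]; last by constructor 3.
  by constructor 1; rewrite L4 -[10]/(4 + 6) leq_add2l.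
rewrite leq_eqVlt => /orP[/eqP/esym L5|L6].
  by constructor 1; rewrite L5 -[10]/(5 + 5) leq_add2l card_covers_five_edges.
case: (pickP [pred u | #|nb u| == 3]) => [u /eqP du|d3].
  case: (pickP [pred v | (v != u) && (#|nb v| == 3)]) => [v /andP[vu /eqP dv]|d3].
    by case: (card_edges_covers_two_nb3 vu dv du); [constructor 1 | constructor 2].
  constructor 1; apply: leq_trans (card_edges_covers_one_nb3 du _ L6) _ => // v vu.
  by have := card_nb_le3 v; have := d3 v; rewrite /= vu /= => /eqP; lia.
constructor 1; apply: leq_trans (card_edges_covers_nb2 _ L6) _ => // v.
by have := card_nb_le3 v; have := d3 v => /= /eqP; lia.
Qed.

End GraphCover.

(** * Links in cross-intersecting pairs *)

Section CrossPair.

Variable T : finType.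
Implicit Types (F G : {set {set T}}) (A B C D S X Y e : {set T}).
Implicit Types (a b c s t u v w x y z : T).

(** Covering number 3 appears in the form in which it is applied: for any two points, an edge
    avoiding both. The symmetry of the record lets every result be used with [F] and [G]
    exchanged. *)
Record cross_pair F G : Prop := CrossPair {
  card_l : {in F, forall A, #|A| = 3};
  card_r : {in G, forall B, #|B| = 3};
  cross_hit : forall A B, A \in F -> B \in G -> exists2 z, z \in A & z \in B;
  tau_l : forall S, #|S| <= 2 -> exists2 A, A \in F & [disjoint S & A];
  tau_r : forall S, #|S| <= 2 -> exists2 B, B \in G & [disjoint S & B]
}.

Lemma cross_pairC F G : cross_pair F G -> cross_pair G F.
Proof.
by case=> F3 G3 FG tF tG; split=> // B A BG AF; have [z zA zB] := FG A B AF BG; exists z.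
Qed.

Definition link G x := [set B :\ x | B in through G x].

Section Pair.

Variables F G : {set {set T}}.
Hypothesis FG : cross_pair F G.

Lemma tau_l2 u v : exists A, [/\ A \in F, u \notin A & v \notin A].
Proof.
have [|A AF dA] := @tau_l _ _ FG [set u; v]; first by rewrite cards2; case: (_ != _).
by exists A; rewrite AF !(disjointFr dA) // !inE eqxx ?orbT.
Qed.

(** An edge of [F] avoiding [u] and [v] contains the third vertex of each edge of [G] through
    both. *)
Lemma card_through2_r_le3 u v : u != v -> #|through2 G u v| <= 3.
Proof.
move=> uv; have [A [AF uA vA]] := tau_l2 u v; rewrite -(card_l FG AF).
apply: card_through2_le => // [B BG|B BG _ _]; first exact: (card_r FG BG).
exact: (cross_hit FG AF BG).
Qed.

Variable x : T.

Lemma link_card2 : {in link G x, forall e, #|e| = 2}.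
Proof.
move=> e /imsetP[B]; rewrite inE => /andP[BG xB] ->.
by have := cardsD1 x B; rewrite xB (card_r FG BG) add1n => -[].
Qed.

Lemma missing_card3 : {in missing F x, forall C, #|C| = 3}.
Proof. by move=> C; rewrite inE => /andP[CF _]; apply: (card_l FG CF). Qed.

Lemma link_hit e C : e \in link G x -> C \in missing F x -> exists2 z, z \in e & z \in C.
Proof.
move=> /imsetP[B]; rewrite !inE => /andP[BG xB] -> /andP[CF xC].
have [z zC zB] := cross_hit FG CF BG; exists z => //.
by rewrite !inE zB andbT; apply: contraNneq xC => <-.
Qed.

Lemma missing_missing v : exists2 C, C \in missing F x & v \notin C.
Proof. by have [A [AF xA vA]] := tau_l2 x v; exists A; rewrite // inE AF. Qed.

Lemma card_link : #|link G x| = #|through G x|.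
Proof.
apply: card_in_imset => B B'; rewrite !inE => /andP[_ xB] /andP[_ xB'] E.
by rewrite -(setD1K xB) E setD1K.
Qed.

Lemma mem_link u v : u != v -> [set u; v] \in link G x ->
  [/\ x != u, x != v & [set x; u; v] \in G].
Proof.
move=> uv /imsetP[B]; rewrite inE => /andP[BG xB] E.
have : u \in B :\ x by rewrite -E !inE eqxx.
have : v \in B :\ x by rewrite -E !inE eqxx orbT.
rewrite !inE => /andP[vx vB] /andP[ux uB]; rewrite ![x == _]eq_sym; split=> //.
by rewrite -(@set3_eq _ B x u v) // ?(card_r FG BG) // eq_sym.
Qed.

Lemma card_nb_link v : x != v -> #|nb (link G x) v| = #|through2 G x v|.
Proof.
move=> xv; rewrite -(card_through_nb link_card2).
have -> : through (link G x) v = [set B :\ x | B in through2 G x v].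
  apply/setP => e; rewrite inE; apply/andP/imsetP => [[/imsetP[B]]|[B]].
    rewrite inE => /andP[BG xB] ->; rewrite !inE => /andP[_ vB].
    by exists B; rewrite // inE BG xB.
  rewrite inE => /and3P[BG xB vB] ->; rewrite !inE eq_sym xv vB; split=> //.
  by apply/imsetP; exists B; rewrite // inE BG.
apply: card_in_imset => B B'; rewrite !inE => /and3P[_ xB _] /and3P[_ xB' _] E.
by rewrite -(setD1K xB) E setD1K.
Qed.

End Pair.

End CrossPair.

(** * Bounding the product of the two sizes *)

Section Degrees.

Variable T : finType.
Implicit Types (F G : {set {set T}}) (A B C D S X Y Z e : {set T}).
Implicit Types (a b c s t u v w x y z : T).

Lemma codeg_missing F G x u v : cross_pair F G -> u != v -> #|through2 (missing F x) u v| <= 3.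
Proof.
move=> FG uv; apply: leq_trans (card_through2_r_le3 (cross_pairC FG) uv).
by apply/subset_leq_card/through2S/subsetP => A; rewrite inE => /andP[].
Qed.

Lemma degree_trichotomy F G x : cross_pair F G -> 3 < #|through G x| ->
  [\/ #|through G x| + #|missing F x| <= 10, #|through G x| = 9 /\ #|missing F x| = 2
    | [/\ #|through G x| = 4, #|missing F x| = 7 & exceptional (link G x) (missing F x)]].
Proof.
move=> FG; rewrite -(card_link G x); apply: (@card_edges_covers _ _ _ _ _ _ _ 3) => //.
- exact: (link_card2 FG (x := x)).
- exact: (missing_card3 FG (x := x)).
- exact: (link_hit FG (x := x)).
- exact: (missing_missing FG x).
- by move=> u v; apply: codeg_missing FG.
Qed.

(* Nine edges at [x] form a complete bipartite graph between [C] and [D]. By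
   disjointness the link of [x] in [F] has no edge between [C] and [D], so its
   vertices of degree 3 lie outside both, while every edge of [G] avoiding [x]
   meets both. *)
Lemma through_nine F G x : cross_pair F G -> [disjoint F & G] -> #|through G x| = 9 ->
  #|missing F x| = 2 /\ (5 < #|through F x| -> #|through F x| + #|missing G x| <= 9).
Proof.
move=> FG dFG; rewrite -(card_link G) => L9; have GF := cross_pairC FG.
have cod u v : u != v -> #|through2 (missing F x) u v| <= 3 by apply: codeg_missing FG.
have [C [D [CF DF dCD H2 CD]]] := nine_edges_bipartite (link_card2 FG (x := x)) (missing_card3 FG (x := x))
  (link_hit FG (x := x)) (missing_missing FG x) cod (leqnn 3) L9.
split=> // p6.
rewrite -(card_link F) in p6 *.
apply: (card_edges_covers_spread (link_card2 GF (x := x)) (missing_card3 GF (x := x))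
  (link_hit GF (x := x)) (missing_missing GF x) p6).
(* A neighbourhood of size 3 is itself an edge of [G], so it meets [X] in some [d]; the triple of
   [x], [u], [d] would then lie in both families. *)
have nbd u X : X \in missing F x -> (forall d, d \in X -> d \in nb (link G x) u) ->
    #|nb (link F x) u| <> 3.
  move=> XF Xu d3; have [E EG uE] := missing_missing GF x u.
  have [d dX dE] : exists2 d, d \in X & d \in E.
    by move: XF EG; rewrite !inE => /andP[XF _] /andP[EG _]; apply: cross_hit FG _ _ _ _.
  have := nb3_eq (missing_card3 GF (x := x)) (link_hit GF (x := x)) d3 EG uE => EE.
  have uG := Xu d dX; rewrite EE inE in dE; rewrite inE in uG.
  have ud : u != d by apply/eqP => ud; have := link_card2 FG uG; rewrite ud setUid cards1.
  have [_ _ AG] := mem_link FG ud uG; have [_ _ AF] := mem_link GF ud dE.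
  by rewrite (disjointFr dFG AF) in AG.
have out u : #|nb (link F x) u| = 3 -> u \notin C /\ u \notin D.
  move=> d3; split; apply/negP => uX.
    by apply: (nbd u D DF _ d3) => d; apply: CD.
  by apply: (nbd u C CF _ d3) => c cC; rewrite nb_sym CD.
move=> E u v EG uE vE /out[uC uD] /out[vC vD].
move: (CF) (DF) (EG); rewrite !inE => /andP[CF' _] /andP[DF' _] /andP[EG' _].
have [c cC cE] := cross_hit FG CF' EG'; have [d dD dE] := cross_hit FG DF' EG'.
have ne z X : z \in X -> u \notin X -> z != u by move=> zX; apply: contraNneq => <-.
have cd : c != d by apply: contraTneq cC => ->; rewrite (disjointFl dCD).
apply/eqP; rewrite eq_sym; move: vE.
rewrite (set3_eq (card_r FG EG') cE dE uE cd (ne c C cC uC) (ne d D dD uD)) mem_set3.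
by case/or3P=> // /eqP vX; [rewrite vX cC in vC | rewrite vX dD in vD].
Qed.

Lemma codeg3_eq F G u v A : cross_pair F G -> u != v -> #|through2 G u v| = 3 ->
  A \in F -> u \notin A -> v \notin A -> A = nb (link G u) v.
Proof.
move=> FG uv c3 AF uA vA.
apply: (nb3_eq (missing_card3 FG (x := u)) (link_hit FG (x := u))); rewrite ?inE ?AF ?uA //.
by rewrite (card_nb_link FG uv).
Qed.

Lemma card_codeg3 F G u v : cross_pair F G -> u != v -> #|through2 G u v| = 3 ->
  #|F| + #|through2 F u v| <= #|through F u| + #|through F v| + 1.
Proof.
move=> FG uv c3; rewrite card_avoid leq_add2l.
apply/card_le1_eqP => A A'; rewrite !inE => /and3P[AF uA vA] /and3P[AF' uA' vA'].
by rewrite (codeg3_eq FG uv c3 AF uA vA) (codeg3_eq FG uv c3 AF' uA' vA').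
Qed.

(** By [codeg3_eq] a single edge [Y] of [G] avoids [a] and [s]; it consists of the vertices
    completing [a], [s] to an edge of [F]. As [t] is not among them, [Y] is also the only edge
    avoiding [a] and [t]. *)
Lemma codeg3_pair F G x a s t : cross_pair F G -> a != s -> a != t -> s != t ->
  #|through2 F a s| = 3 -> #|through2 F a t| = 3 ->
  (forall A, A \in F -> a \in A -> s \in A -> t \in A -> False) ->
  (forall B, B \in G -> x \in B -> a \notin B -> s \in B) ->
  exists Y, [/\ Y \in avoid G x a, s \notin Y, t \notin Y &
    forall Z, Z \in G -> a \notin Z -> Z != Y -> s \in Z /\ t \in Z].
Proof.
move=> FG as_ at_ st cs ct nst Gx; have GF := cross_pairC FG.
have [Y [YG aY sY]] := tau_l2 GF a s; have YE := codeg3_eq GF as_ cs YG aY sY.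
have tY : t \notin Y.
  by rewrite YE inE; apply/negP => /(mem_link GF st)[_ _ AF]; apply: (nst _ AF); rewrite mem_set3 eqxx ?orbT.
have xY : x \notin Y by apply: contra sY => xY; apply: Gx YG xY aY.
exists Y; split=> //; first by rewrite inE YG xY.
move=> Z ZG aZ ZY; split; apply: contraNT ZY => nZ.
  by rewrite (codeg3_eq GF as_ cs ZG aZ nZ) -YE.
by rewrite (codeg3_eq GF at_ ct ZG aZ nZ) (codeg3_eq GF at_ ct YG aY tY).
Qed.

(* The exceptional configuration at [x] reproduces itself at the vertex [a] of
   its three edges. The three edges of [G] avoiding [x] and [a] would then have
   to contain two pairs [st] and [uv], with only one exception for each pair. *)
Lemma not_exceptional F G x : cross_pair F G -> #|G| = 8 -> #|through F x| = 6 ->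
  #|through G x| = 4 ->
  (forall a, 5 < #|through F a| -> #|through F a| = 6 /\ #|through G a| = 4) ->
  ~ exceptional (link G x) (missing F x).
Proof.
move=> FG G8 px qx pq [a [s [t [[da st ast stL] [p6 cs ct nst]]]]]; have GF := cross_pairC FG.
have sub : through (missing F x) a \subset through F a.
  by apply/subsetP => A; rewrite !inE => /andP[/andP[-> _] ->].
have [pa qa] : #|through F a| = 6 /\ #|through G a| = 4.
  by apply: pq; have := subset_leq_card sub; rewrite p6.
(* The six edges of [F] through [a] and missing [x] are all those through [a]. *)
have ax A : A \in F -> a \in A -> x \notin A.
  move=> AF aA; have : A \in through F a by rewrite inE AF.
  have /eqP <- : through (missing F x) a == through F a by rewrite eqEcard sub pa p6.
  by rewrite !inE => /andP[/andP[]].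
have xa : x != a.
  apply/eqP => xa; have : #|through (missing F x) a| == 0; last by rewrite p6.
  by rewrite cards_eq0; apply/eqP/setP => A; rewrite !inE -xa; case: (x \in A); rewrite ?andbF.
have th2 z : through2 (missing F x) a z = through2 F a z.
  apply/setP => A; rewrite !inE; case AF: (A \in F) => //=; case aA: (a \in A); rewrite ?andbF //.
  by rewrite (ax A AF aA).
rewrite !th2 in cs ct; have {}nst A : A \in F -> a \in A -> s \in A -> t \in A -> False.
  by move=> AF aA; apply: (nst A) => //; rewrite inE AF ax.
have [xs xt BG] := mem_link FG st stL.
have [as_ at_] : a != s /\ a != t by move: ast; rewrite !inE negb_or => /andP[].
have c3 : #|through2 G x a| = 3 by rewrite -(card_nb_link FG xa).
(* Three of the four edges of [G] at [x] contain [a], and conversely. So [[set x; s; t]] is the only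
   one with [x] but not [a], and [B0] the only one with [a] but not [x]. *)
have one y z : #|through G y| = 4 -> #|through2 G y z| = 3 -> #|missing (through G y) z| = 1.
  move=> qy cyz; have := card_through_missing (through G y) z; rewrite qy.
  rewrite (_ : through (through G y) z = through2 G y z) ?cyz; last first.
    by apply/setP => B; rewrite !inE andbA.
  by clear; lia.
have /eqP/cards1P[B1 B1E] := one x a qx c3.
have /eqP/cards1P[B0 B0E] : #|missing (through G a) x| = 1 by apply: one; rewrite // through2C.
have Gxa B : B \in G -> x \in B -> a \notin B -> B = [set x; s; t].
  have in1 C : C \in G -> x \in C -> a \notin C -> C = B1.
    by move=> CG xC aC; apply/set1P; rewrite -B1E !inE CG xC.
  move=> BG' xB aB; rewrite (in1 B) // [RHS]in1 // mem_set3 ?eqxx // eq_sym (negbTE xa) /=.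
  by rewrite negb_or as_.
have : B0 \in missing (through G a) x by rewrite B0E set11.
rewrite !inE => /andP[/andP[B0G aB0] xB0].
have Gax B : B \in G -> a \in B -> x \notin B -> B = B0.
  by move=> BG' aB xB; apply/set1P; rewrite -B0E !inE BG' aB.
have [u [v [au av uv B0uv]]] := card3_others (card_r FG B0G) aB0.
have [uB0 vB0] : u \in B0 /\ v \in B0 by rewrite B0uv !mem_set3 !eqxx !orbT.
have [xu xv] : x != u /\ x != v by split; apply: contraNneq xB0 => ->.
(* Edges of [F] through [x] avoid [a], so they meet [B0] in [u] or [v]. There are six, and codegrees
   are at most 3, so equality holds: [x], [u], [v] now play the role of [a], [s], [t]. *)
have subx : through F x \subset through2 F x u :|: through2 F x v.
  apply/subsetP => A; rewrite !inE => /andP[AF xA]; rewrite AF xA /=.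
  have [z zA] := cross_hit FG AF B0G; rewrite B0uv mem_set3 => /or3P[] /eqP zE; subst z.
  - by have := ax A AF zA; rewrite xA.
  - by rewrite zA.
  - by rewrite zA orbT.
have := subset_leq_card subx; rewrite px cardsU => cuv.
have cu := card_through2_r_le3 GF xu; have cv := card_through2_r_le3 GF xv.
have [c3u c3v I0] : [/\ #|through2 F x u| = 3, #|through2 F x v| = 3 &
    #|through2 F x u :&: through2 F x v| = 0] by move: cuv cu cv; clear; move=> *; split; lia.
have nuv A : A \in F -> x \in A -> u \in A -> v \in A -> False.
  move=> AF xA uA vA; move: I0 => /eqP; rewrite cards_eq0 => /eqP/setP/(_ A).
  by rewrite !inE AF xA uA vA.
have [Y1 [Y1a sY1 tY1 Y1u]] : exists Y, [/\ Y \in avoid G x a, s \notin Y, t \notin Y &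
    forall Z, Z \in G -> a \notin Z -> Z != Y -> s \in Z /\ t \in Z].
  apply: (codeg3_pair FG) => // B BG' xB aB.
  by rewrite (Gxa B BG' xB aB) mem_set3 eqxx orbT.
have [Y2 [Y2a uY2 vY2 Y2u]] : exists Y, [/\ Y \in avoid G a x, u \notin Y, v \notin Y &
    forall Z, Z \in G -> x \notin Z -> Z != Y -> u \in Z /\ v \in Z].
  by apply: (codeg3_pair FG) => // B BG' aB xB; rewrite (Gax B BG' aB xB).
have avC : avoid G a x = avoid G x a.
  by apply/setP => B; rewrite !inE [(x \notin B) && _]andbC.
rewrite avC in Y2a; have av3 : #|avoid G x a| = 3.
  by have := card_avoid G x a; rewrite G8 c3 qx qa; clear; lia.
have all4 Z : Z \in avoid G x a -> Z != Y1 -> Z != Y2 ->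
    [/\ Z \in G, s \in Z /\ t \in Z & u \in Z /\ v \in Z].
  by rewrite inE => /and3P[ZG xZ aZ] Z1 Z2; split; [|apply: Y1u|apply: Y2u].
(* If the exceptions differ, the third edge [Z] contains [s], [t], [u], [v]. These are four
   vertices, because [Y2] contains [s] and [t] but neither [u] nor [v]. *)
have [Y12|Y12] := eqVneq Y1 Y2; last first.
  have Y21 : Y2 != Y1 by rewrite eq_sym.
  have : 0 < #|(avoid G x a :\ Y1) :\ Y2|.
    have := cardsD1 Y2 (avoid G x a :\ Y1); have := cardsD1 Y1 (avoid G x a).
    by rewrite Y1a av3 in_setD1 Y2a Y21 /= !add1n => -[<-] [<-].
  case/card_gt0P => Z; rewrite !in_setD1 => /and3P[Z2 Z1 Za].
  have [ZG [sZ tZ] [uZ vZ]] := all4 Z Za Z1 Z2.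
  have [sY2 tY2] : s \in Y2 /\ t \in Y2.
    by move: Y2a; rewrite inE => /and3P[Y2G _ aY2]; apply: Y1u; rewrite // eq_sym.
  have ne y z : y \in Y2 -> z \notin Y2 -> y != z by move=> yY; apply: contraNneq => <-.
  have := vZ; rewrite (set3_eq (card_r FG ZG) sZ tZ uZ st (ne s u sY2 uY2) (ne t u tY2 uY2)).
  rewrite mem_set3 => /or3P[] /eqP vE.
  - by have := ne s v sY2 vY2; rewrite vE eqxx.
  - by have := ne t v tY2 vY2; rewrite vE eqxx.
  - by rewrite vE eqxx in uv.
(* If they agree, two edges contain all of [s], [t], [u], [v], so the two pairs coincide. Together
   with [[set x; s; t]] and [B0] this gives [s], [t] codegree 4. *)
subst Y2; have : #|avoid G x a :\ Y1| == 2.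
  by have := cardsD1 Y1 (avoid G x a); rewrite Y1a av3 add1n => -[<-].
case/cards2P=> Z [Z' [ZZ' avE]].
have [Za Za'] : Z \in avoid G x a :\ Y1 /\ Z' \in avoid G x a :\ Y1 by rewrite avE !inE !eqxx orbT.
move: Za Za'; rewrite !in_setD1 => /andP[Z1 Za] /andP[Z1' Za'].
have [ZG [sZ tZ] [uZ vZ]] := all4 Z Za Z1 Z1; have [ZG' [sZ' tZ'] [uZ' vZ']] := all4 Z' Za' Z1' Z1'.
have inst w : w \in Z -> w \in Z' -> w \in [set s; t].
  move=> wZ wZ'; apply: contraNT ZZ'; rewrite !inE negb_or ![w == _]eq_sym => /andP[sw tw].
  by rewrite (set3_eq (card_r FG ZG) sZ tZ wZ st sw tw) (set3_eq (card_r FG ZG') sZ' tZ' wZ' st sw tw).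
have /eqP uvE : [set u; v] == [set s; t].
  by rewrite eqEcard !cards2 uv st andbT subUset !sub1set !inst.
have := card_through2_r_le3 FG st; apply/negP; rewrite -ltnNge.
have sub4 : [set [set x; s; t]; B0] :|: [set Z; Z'] \subset through2 G s t.
  apply/subsetP => B; rewrite !inE => /orP[/orP[]|/orP[]] /eqP ->.
  - by rewrite BG !mem_set3 !eqxx !orbT.
  - have stB0 : [set s; t] \subset B0 by rewrite -uvE subUset !sub1set uB0.
    by rewrite B0G !(subsetP stB0) // !inE eqxx ?orbT.
  - by rewrite ZG sZ.
  - by rewrite ZG' sZ'.
apply: leq_trans (subset_leq_card sub4).
move: Za Za'; rewrite !inE => /and3P[_ xZ aZ] /and3P[_ xZ' aZ'].
have xB1 : x \in [set x; s; t] by rewrite mem_set3 eqxx.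
rewrite cardsU !cards2 ZZ' (_ : _ :&: _ = set0) ?cards0; last first.
  apply/setP => B; rewrite !inE; apply/negbTE/negP => /andP[/orP[] /eqP -> /orP[] /eqP E].
  - by rewrite E (negbTE xZ) in xB1.
  - by rewrite E (negbTE xZ') in xB1.
  - by rewrite E (negbTE aZ) in aB0.
  - by rewrite E (negbTE aZ') in aB0.
by rewrite (_ : [set x; s; t] != B0) //; apply: contraNneq xB0 => <-.
Qed.

(** * A vertex of degree at least 4 in both families *)

Lemma mul_le100 m n : m + n <= 20 -> m * n <= 100.
Proof.
move=> mn; rewrite -(leq_pmul2l (isT : 0 < 4)) (leq_trans (nat_AGM2 m n)) //.
by rewrite -[4 * 100]/(20 ^ 2) leq_exp2r.
Qed.

Lemma through_nine_small F G x : cross_pair F G -> [disjoint F & G] ->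
  #|through G x| = 9 -> 3 < #|through F x| -> #|F| * #|G| <= 100.
Proof.
move=> FG dFG q9 p4; have [f2 p6] := through_nine FG dFG q9.
rewrite (card_through_missing F x) (card_through_missing G x) f2 q9.
(* For degree 4 or 5 in [F] the sum may be 21, but the product is at most 6 * 15, 7 * 14, or 6 * 16
   in the exceptional case. *)
have [p5|/p6 pg] := leqP #|through F x| 5; last by apply: mul_le100; lia.
case: (degree_trichotomy (cross_pairC FG) p4) => [pg|[p9 _]|[p44 g7 _]].
- by move: p4 p5 pg; clear; nia.
- by rewrite p9 in p5.
- by rewrite p44 g7.
Qed.

(** A product above 100 would force |G| = 8, and degrees 6 in [F] and 4 in [G] both at [x] and at
    every vertex of degree at least 6 in [F], which is the situation refuted by
    [not_exceptional]. *)
Lemma exceptional_small F G x : cross_pair F G -> [disjoint F & G] ->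
  3 < #|through F x| -> #|through G x| = 4 -> #|missing F x| = 7 ->
  exceptional (link G x) (missing F x) -> #|F| * #|G| <= 100.
Proof.
move=> FG dFG p4 q4 f7 exc; rewrite leqNgt; apply/negP => big; have GF := cross_pairC FG.
have dGF : [disjoint G & F] by rewrite disjoint_sym.
have cF := card_through_missing F x; have cG := card_through_missing G x.
have G8 : 8 <= #|G|.
  move: big; rewrite cF cG f7 q4.
  case: (degree_trichotomy GF p4) => [pg|[-> ->]|[-> -> _]] //.
  by move: p4 pg; clear; nia.
have FG20 : 20 < #|F| + #|G| by rewrite ltnNge; apply: contraL big => /mul_le100; rewrite -leqNgt.
have key a : 5 < #|through F a| -> [/\ #|through F a| = 6, #|through G a| = 4 & #|G| = 8].
  move=> pa; have cFa := card_through_missing F a; have cGa := card_through_missing G a.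
  case: (degree_trichotomy GF (ltnW (ltnW pa))) => [pg|[p9 g2]|[p44 _ _]]; last by rewrite p44 in pa.
    have qa : 3 < #|through G a| by move: pa pg G8 cGa; clear; lia.
    case: (degree_trichotomy FG qa) => [qf|[q9 _]|[q44 _ _]].
    - by move: qf pg FG20 cFa cGa; clear; lia.
    - by have := through_nine_small FG dFG q9 (ltnW (ltnW pa)); rewrite leqNgt big.
    - by move: q44 pg pa G8 cGa; clear; move=> *; split; lia.
  have qa : 3 < #|through G a| by move: g2 G8 cGa; clear; lia.
  by have := through_nine_small GF dGF p9 qa; rewrite mulnC leqNgt big.
have [a [s [t [_ [p6 _ _ _]]]]] := exc.
have pa : 5 < #|through F a|.
  rewrite -p6; apply/subset_leq_card/subsetP => A; rewrite !inE.
  by case/andP=> /andP[-> _] ->.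
have [_ _ G8E] := key a pa.
have p6x : #|through F x| = 6.
  case: (degree_trichotomy GF p4) => [pg|[p9 g2]|[p44 g7 _]].
  - by move: big pg; rewrite cF f7 G8E; move: cG; rewrite q4 G8E; clear; lia.
  - by move: cG; rewrite q4 g2 G8E.
  - by move: cG; rewrite q4 g7 G8E.
by apply: (not_exceptional FG G8E p6x q4 _ exc) => b /key[].
Qed.

Lemma degrees_not_both_gt3 F G x : cross_pair F G -> [disjoint F & G] -> 100 < #|F| * #|G| ->
  3 < #|through F x| -> 3 < #|through G x| -> False.
Proof.
move=> FG dFG big p4 q4; have GF := cross_pairC FG.
have dGF : [disjoint G & F] by rewrite disjoint_sym.
case: (degree_trichotomy FG q4) => [qf|[q9 _]|[q44 f7 exc]].
- case: (degree_trichotomy GF p4) => [pg|[p9 _]|[p44 g7 exc]].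
  + suff /mul_le100 : #|F| + #|G| <= 20 by rewrite leqNgt big.
    by rewrite (card_through_missing F x) (card_through_missing G x); move: qf pg; clear; lia.
  + by have := through_nine_small GF dGF p9 q4; rewrite mulnC leqNgt big.
  + by have := exceptional_small GF dGF q4 p44 g7 exc; rewrite mulnC leqNgt big.
- by have := through_nine_small FG dFG q9 p4; rewrite leqNgt big.
- by have := exceptional_small FG dFG p4 q44 f7 exc; rewrite leqNgt big.
Qed.

(** * No vertex of degree at least 4 in both families *)

Lemma exists_heavy F G : cross_pair F G -> exists x, #|G| <= 3 * #|through G x|.
Proof.
move=> FG; have [|A AF _] := tau_l FG (S := set0); first by rewrite cards0.
have [x0 x0A] : exists x, x \in A by apply/set0Pn; rewrite -card_gt0 (card_l FG AF).
have [y [z [_ _ _ AE]]] := card3_others (card_l FG AF) x0A.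
have : #|G| <= #|through G x0| + #|through G y| + #|through G z|.
  apply: (@leq_trans #|(through G x0 :|: through G y) :|: through G z|).
    apply/subset_leq_card/subsetP => B BG; rewrite !inE BG /=.
    by have [w] := cross_hit FG AF BG; rewrite AE mem_set3 => /or3P[] /eqP -> ->; rewrite ?orbT.
  by apply: leq_trans (leq_card_setU _ _) _; rewrite leq_add2r leq_card_setU.
have [xh|xl] := leqP #|G| (3 * #|through G x0|); first by exists x0.
have [yh|yl] := leqP #|G| (3 * #|through G y|); first by exists y.
by exists z; move: xl yl; lia.
Qed.

Lemma card_through_le9 F G x : cross_pair F G -> #|through G x| <= 9.
Proof.
move=> FG; rewrite -(card_link G x); have [->|L0] := eqVneq (link G x) set0; first by rewrite cards0.
apply: (card_edges_le9 (link_card2 FG (x := x)) (missing_card3 FG (x := x)) (link_hit FG (x := x))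
  (missing_missing FG x) L0).
Qed.

Lemma degrees_le3 F G : cross_pair F G -> [disjoint F & G] -> 100 < #|F| * #|G| ->
  #|F| <= #|G| ->
  [/\ #|F| <= 9, forall x, #|through F x| <= 3 &
      forall x, 3 < #|through G x| -> #|through G x| + #|F| <= 10 + #|through F x|
        \/ #|through G x| = 9 /\ #|F| = #|through F x| + 2].
Proof.
move=> FG dFG big leFG; have GF := cross_pairC FG.
have not4 x := degrees_not_both_gt3 (x := x) FG dFG big.
have G11 : 10 < #|G|.
  by rewrite ltnNge; apply: contraL big => G10; rewrite -leqNgt (leq_mul (leq_trans leFG G10) G10).
(* The centre [a] of the configuration has degree at least 6 in [F], hence at most 3 in [G], and at
   most four edges of [G] miss it. *)
have noexc y : 3 < #|through G y| -> ~ exceptional (link G y) (missing F y).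
  move=> q4 [a [s [t [_ [p6 _ _ _]]]]].
  have pa : 5 < #|through F a|.
    rewrite -p6; apply/subset_leq_card/subsetP => A; rewrite !inE.
    by case/andP=> /andP[-> _] ->.
  have qa : #|through G a| <= 3 by rewrite leqNgt; apply/negP; apply: not4 (ltnW (ltnW pa)).
  have := card_through_missing G a.
  case: (degree_trichotomy GF (ltnW (ltnW pa))) => [pg|[p9 g2]|[p44 _ _]].
  - by move: pa qa pg G11; clear; lia.
  - by move: qa g2 G11; clear; lia.
  - by rewrite p44 in pa.
have Q x : 3 < #|through G x| -> #|through G x| + #|F| <= 10 + #|through F x|
        \/ #|through G x| = 9 /\ #|F| = #|through F x| + 2.
  move=> q4; rewrite (card_through_missing F x).
  case: (degree_trichotomy FG q4) => [qf|[-> ->]|[_ _ exc]]; last by case: (noexc x q4 exc).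
    by left; move: qf; clear; lia.
  by right.
have F9 : #|F| <= 9.
  have [x xh] := exists_heavy FG.
  have q4 : 3 < #|through G x| by move: xh G11; clear; lia.
  have px : #|through F x| <= 3 by rewrite leqNgt; apply/negP => p4; apply: not4 p4 q4.
  by case: (Q x q4) => [|[_ ->]]; move: px q4; clear; lia.
(* Otherwise |G| is at most 3 + 7, the exceptional case being the worst. *)
split=> // y; rewrite leqNgt; apply/negP => p4.
have qy : #|through G y| <= 3 by rewrite leqNgt; apply/negP; apply: not4 p4.
have := card_through_missing G y.
case: (degree_trichotomy GF p4) => [pg|[p9 g2]|[p44 g7 _]] => [cG|cG|cG].
- by move: p4 qy pg G11 cG; clear; lia.
- by move: qy g2 G11 cG; clear; lia.
- by move: qy g7 G11 cG; clear; lia.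
Qed.

Lemma card2_inter C X y z : #|C| = 3 -> #|X| = 2 -> X \subset C -> y \in C -> z \in C ->
  y \notin X -> z \notin X -> y = z.
Proof.
move=> C3 X2 XC yC zC yX zX; have : #|C :\: X| = 1 by rewrite cardsD (setIidPr XC) C3 X2.
move/eqP/cards1P => [w E].
have : y \in C :\: X by rewrite inE yX.
have : z \in C :\: X by rewrite inE zX.
by rewrite E => /set1P -> /set1P ->.
Qed.

(* As all eight transversals are in [G], an edge of [F] avoiding [x] contains one
   of the [e_i], two of which are contained in two such edges each. This
   exhausts the degrees of their vertices, and leaves room for one edge of [G]
   through [x] only. *)
Lemma matching_link_small F G x e1 e2 e3 : cross_pair F G -> (forall y, #|through F y| <= 3) ->
  link F x = [set e1; e2; e3] -> [disjoint e1 & e2] -> [disjoint e1 & e3] -> [disjoint e2 & e3] ->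
  8 <= #|missing G x| -> 5 <= #|missing F x| -> #|through G x| <= 1.
Proof.
move=> FG p3 LE d12 d13 d23 g8 f5; have GF := cross_pairC FG.
pose W e := [set D in missing F x | e \subset D].
have TP e D : D \in W e -> [/\ D \in F, x \notin D & e \subset D].
  by rewrite !inE => /andP[/andP[]].
have two e : e \in link F x -> #|e| = 2 by apply: link_card2 GF _ _.
have liftF e : e \in link F x -> x |: e \in F.
  by case/imsetP=> A; rewrite inE => /andP[AF xA] ->; rewrite setD1K.
have dj e e' D : e \in link F x -> e' \in link F x -> [disjoint e & e'] -> D \in F ->
    e \subset D -> e' \subset D -> False.
  move=> /two e2' /two e2'' dee DF eD eD'.
  have : #|e :|: e'| <= 3 by rewrite -(card_l FG DF) subset_leq_card // subUset eD.
  by rewrite cardsU e2' e2'' (disjoint_setI0 dee) cards0.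
have subT e v : e \in link F x -> v \in e -> (x |: e) |: W e \subset through F v.
  move=> eL ve; apply/subsetP => A; rewrite in_setU1 => /orP[/eqP ->|/TP[AF _ /subsetP eA]].
    by rewrite inE liftF // in_setU1 ve orbT.
  by rewrite inE AF eA.
have liftT e : x |: e \notin W e by rewrite !inE eqxx /= andbF.
have T2 e : e \in link F x -> #|W e| <= 2.
  move=> eL; have /eqP/cards2P[v [w [_ eE]]] := two e eL.
  have ve : v \in e by rewrite eE !inE eqxx.
  have := leq_trans (subset_leq_card (subT e v eL ve)) (p3 v).
  by rewrite cardsU1 liftT add1n ltnS.
(* The edge [x |: e] and two edges in [W e] exhaust the degree 3 of [v]. *)
have sat e A v : e \in link F x -> 1 < #|W e| -> A \in F -> v \in e -> v \in A -> e \subset A.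
  move=> eL Te AF ve vA; apply/negPn/negP => eA.
  have : #|A |: ((x |: e) |: W e)| <= 3.
    apply: leq_trans (p3 v); apply/subset_leq_card; rewrite subUset subT // andbT.
    by rewrite sub1set inE AF.
  rewrite !cardsU1 liftT in_setU1 negb_or.
  have -> : A != x |: e by apply: contraNneq eA => ->; apply: subsetUr.
  have -> : A \notin W e by apply: contra eA => /TP[].
  by move=> W1; have := leq_ltn_trans W1 (_ : 3 < 2 + #|W e|); rewrite ltnn => /(_ Te).
have main f1 f2 f3 : f1 \in link F x -> f2 \in link F x -> f3 \in link F x ->
    [disjoint f1 & f2] -> [disjoint f1 & f3] -> [disjoint f2 & f3] ->
    1 < #|W f1| -> 1 < #|W f2| -> 0 < #|W f3| -> #|through G x| <= 1.
  move=> f1L f2L f3L d12' d13' d23' T1 T2' /card_gt0P[C /TP[CF xC f3C]].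
  (* If [s] were in [f], saturation would keep it out of [C] and of all edges in [W f'], so all of
     these contain the other end [t]. But [t] in [f'] puts [f'] and [f3] into [C], and [t] outside
     [f'] makes [W f'] a singleton. *)
  have out f f' e s : f \in link F x -> f' \in link F x -> [disjoint f & f'] ->
      [disjoint f & f3] -> [disjoint f' & f3] -> 1 < #|W f| -> 1 < #|W f'| ->
      e \in link G x -> s \in e -> s \notin f.
    move=> fL f'L dff df3 df'3 Tf Tf' eL se; apply/negP => sf.
    have [t st eE] := card2_other (link_card2 FG eL) se.
    have tin D : D \in F -> x \notin D -> s \notin D -> t \in D.
      move=> DF xD sD; have DM : D \in missing F x by rewrite inE DF.
      by have [z] := link_hit FG eL DM; rewrite eE !inE => /orP[] /eqP -> //; rewrite (negbTE sD).
    have tC : t \in C.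
      by apply: tin => //; apply/negP => sC; apply: (dj f f3 C) => //; apply: sat sf sC.
    have tT D : D \in W f' -> t \in D.
      case/TP=> DF xD f'D; apply: tin => //; apply/negP => sD.
      by apply: (dj f f' D) => //; apply: sat sf sD.
    have [tf'|tf'] := boolP (t \in f').
      by apply: (dj f' f3 C) => //; apply: sat tf' tC.
    have /card_gt1P[D [D' [DT DT']]] := Tf'; apply/negP; rewrite negbK.
    have eqD E : E \in W f' -> E = t |: f'.
      move=> ET; have [EF _ f'E] := TP f' E ET; apply/esym/eqP.
      by rewrite eqEcard cardsU1 tf' (two _ f'L) (card_l FG EF) subUset sub1set tT ?f'E.
    by rewrite (eqD D DT) (eqD D' DT').
  have /card_gt1P[D [D' [DT DT' DD']]] := T1.
  have [DF xD fD] := TP f1 D DT; have [DF' xD' fD'] := TP f1 D' DT'.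
  have hit e E : e \in link G x -> E \in W f1 -> exists y, [/\ y \in e, y \in E & y \notin f1].
    move=> eL ET; have EM : E \in missing F x by move: ET; rewrite inE => /andP[].
    have [y ye yE] := link_hit FG eL EM; exists y; split=> //.
    by apply: (out f1 f2 e).
  (* [D] and [D'] each have one vertex outside [f1]; these differ, and both must lie in [e], which
     is thereby determined. *)
  have eqE e : e \in link G x -> exists y y', [/\ e = [set y; y'], y \in D :\: f1 & y' \in D' :\: f1].
    move=> eL; have [y [ye yD yf]] := hit e D eL DT; have [y' [ye' yD' yf']] := hit e D' eL DT'.
    exists y, y'; rewrite !in_setD yD yD' yf yf'; split=> //; apply/esym/eqP.
    rewrite eqEcard (link_card2 FG eL) subUset !sub1set ye ye' cards2 /=.
    rewrite (_ : y != y') //; apply: contraNneq DD' => yy; subst y'.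
    have eqD E : E \in W f1 -> y \in E -> E = y |: f1.
      move=> ET yE; have [EF _ f1E] := TP f1 E ET; apply/esym/eqP.
      by rewrite eqEcard cardsU1 yf (two _ f1L) (card_l FG EF) subUset sub1set yE f1E.
    by rewrite (eqD D DT yD) (eqD D' DT' yD').
  rewrite -(card_link G x); apply/card_le1_eqP => e e' /eqE[y [y' [-> + +]]] /eqE[z [z' [-> + +]]].
  rewrite !inE => /andP[yf yD] /andP[yf' yD'] /andP[zf zD] /andP[zf' zD'].
  rewrite (card2_inter (card_l FG DF) (two _ f1L) fD yD zD yf zf).
  by rewrite (card2_inter (card_l FG DF') (two _ f1L) fD' yD' zD' yf' zf').
have [e1L e2L e3L] : [/\ e1 \in link F x, e2 \in link F x & e3 \in link F x].
  by rewrite LE !mem_set3 !eqxx !orbT.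
have [_ /(_ g8) all8] := card_covers_matching (link_card2 GF (x := x)) (missing_card3 GF (x := x))
  (link_hit GF (x := x)) e1L e2L e3L d12 d13 d23.
have cover : missing F x \subset (W e1 :|: W e2) :|: W e3.
  apply/subsetP => D DM; rewrite !in_setU ![_ \in W _]inE DM /=.
  apply/negPn/negP; rewrite !negb_or => /andP[/andP[/subsetPn[t1 t1e t1D] /subsetPn[t2 t2e t2D]]].
  case/subsetPn=> t3 t3e t3D; have := all8 t1 t2 t3 t1e t2e t3e; rewrite inE => /andP[BG _].
  have DF : D \in F by move: DM; rewrite inE => /andP[].
  have [z zD] := cross_hit FG DF BG; rewrite mem_set3 => /or3P[] /eqP zE; subst z.
  - by rewrite zD in t1D.
  - by rewrite zD in t2D.
  - by rewrite zD in t3D.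
have : 5 <= #|W e1| + #|W e2| + #|W e3|.
  apply: leq_trans f5 (leq_trans (subset_leq_card cover) _).
  by apply: leq_trans (leq_card_setU _ _) _; rewrite leq_add2r leq_card_setU.
have := T2 e1 e1L; have := T2 e2 e2L; have := T2 e3 e3L.
have [t1|t1] := leqP #|W e1| 1.
  move=> t3 t2 _ t5; apply: (main e2 e3 e1); rewrite // 1?disjoint_sym //;
    by move: t1 t2 t3 t5; clear; lia.
have [t2|t2] := leqP #|W e2| 1.
  move=> t3 _ t1' t5; apply: (main e1 e3 e2); rewrite // 1?disjoint_sym //;
    by move: t1' t2 t3 t5; clear; lia.
move=> _ t2' t1' t5; apply: (main e1 e2 e3) => //.
by move: t1' t2' t5; clear; lia.
Qed.

Lemma through_missing_le F x c : #|through (missing F x) c| <= #|through F c|.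
Proof. by apply/subset_leq_card/subsetP => A; rewrite !inE => /andP[/andP[-> _] ->]. Qed.

Lemma missing_deg2 F G x k : cross_pair F G -> #|through F x| = 2 ->
  (forall u v, u != v -> #|through2 G u v| <= k) ->
  #|missing G x| <= 4 * k \/ exists c, #|missing G x| <= #|through G c| + k.
Proof.
move=> FG; have GF := cross_pairC FG; rewrite -(card_link F x) => p2 cod.
have cod' u v : u != v -> #|through2 (missing G x) u v| <= k.
  move=> /cod; apply: leq_trans; apply/subset_leq_card/through2S/subsetP => A.
  by rewrite inE => /andP[].
case: (card_covers_two_edges (link_card2 GF (x := x)) (link_hit GF (x := x)) cod' p2) => [|[c h]].
  by left.
by right; exists c; apply: leq_trans h _; rewrite leq_add2r through_missing_le.
Qed.

Lemma missing_deg3 F G x k : cross_pair F G -> (forall y, #|through F y| <= 3) ->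
  #|through F x| = 3 -> (forall u v, u != v -> #|through2 G u v| <= k) ->
  [\/ #|missing G x| <= 8 /\ (8 <= #|missing G x| -> 5 <= #|missing F x| -> #|through G x| <= 1),
      exists c, #|missing G x| <= #|through G c| + 1, #|missing G x| <= 2 * k + 2
    | exists u v, [/\ u != v, [set x; u; v] \in F & #|missing G x| <= #|through2 G u v| + 2 * k]].
Proof.
move=> FG p3; have GF := cross_pairC FG; rewrite -(card_link F x) => px cod.
have sub u v : #|through2 (missing G x) u v| <= #|through2 G u v|.
  by apply/subset_leq_card/through2S/subsetP => A; rewrite inE => /andP[].
have cod' u v : u != v -> #|through2 (missing G x) u v| <= k.
  by move=> /cod; apply: leq_trans.
case: (card_covers_three_edges (link_card2 GF (x := x)) (missing_card3 GF (x := x))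
  (link_hit GF (x := x)) (missing_missing GF x) cod' px).
- case=> e1 [e2 [e3 [LE d12 d13 d23]]]; constructor 1; split.
    have [e1L e2L e3L] : [/\ e1 \in link F x, e2 \in link F x & e3 \in link F x].
      by rewrite LE !mem_set3 !eqxx !orbT.
    by case: (card_covers_matching (link_card2 GF (x := x)) (missing_card3 GF (x := x))
      (link_hit GF (x := x)) e1L e2L e3L d12 d13 d23).
  exact: (matching_link_small FG p3 LE d12 d13 d23).
- case=> c h; constructor 2; exists c; apply: leq_trans h _.
  by rewrite leq_add2r through_missing_le.
- by constructor 3.
- case=> u [v [vu h]]; constructor 4; exists u, v; have uv := nb_neq (link_card2 GF (x := x)) vu.
  rewrite inE in vu; have [_ _ AF] := mem_link GF uv vu; split=> //.
  by apply: leq_trans h _; rewrite leq_add2r.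
Qed.

(** For each size of [F] from 4 to 9, [Q] and [xh] fix the degrees of the heavy vertex [x] within
    narrow limits. The edges of [G] missing [x] are then more than a graph with two or three edges
    admits as covers. *)
Lemma degrees_le3_absurd F G : cross_pair F G -> 100 < #|F| * #|G| ->
  #|F| <= 9 -> (forall x, #|through F x| <= 3) ->
  (forall x, #|through G x| = 9 -> #|F| = #|through F x| + 2) ->
  (forall x, 3 < #|through G x| -> #|through G x| + #|F| <= 10 + #|through F x|
        \/ #|through G x| = 9 /\ #|F| = #|through F x| + 2) -> False.
Proof.
move=> FG big F9 p3 q9 Q; have GF := cross_pairC FG.
have le9 y := card_through_le9 y FG.
have cG y := card_through_missing G y; have cF y := card_through_missing F y.
have cod3 u v : u != v -> #|through2 G u v| <= 3 by apply: (card_through2_r_le3 FG).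
have [x xh] := exists_heavy FG.
have f4 : 3 < #|F|.
  rewrite ltnNge; apply: contraL big => f3; rewrite -leqNgt.
  have G27 : #|G| <= 27 by apply: leq_trans xh _; rewrite -[27]/(3 * 9) leq_mul2l le9.
  exact: leq_trans (leq_mul f3 G27) _.
have Q6 y : 5 < #|F| -> #|through G y| + #|F| <= 10 + #|through F y| \/ #|through G y| <= 3.
  move=> f6; have [q4|q4] := leqP #|through G y| 3; first by right.
  by left; have := Q y q4; have := p3 y; move: f6; clear; lia.
(* At a vertex of degree 3, [missing_deg3] allows at most nine missing edges of [G], and nine only
   with a codegree 3, which [card_codeg3] excludes if |F| = 7. But ten are needed if |F| = 6, and
   nine if |F| = 7. *)
have no3 : 5 < #|F| -> #|F| <= 7 -> forall y, #|through F y| <= 2.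
  move=> f6 f7 y; rewrite leqNgt; apply/negP => py.
  have {}py : #|through F y| = 3 by apply/eqP; rewrite eqn_leq p3.
  have Qy := Q6 y f6; rewrite py in Qy; have := cG y.
  have {}f67 : #|F| = 6 \/ #|F| = 7 by move: f6 f7; clear; lia.
  have gb : 17 <= #|G| \/ #|F| = 7 /\ 15 <= #|G| by case: f67 big => ->; clear; lia.
  case: (missing_deg3 FG p3 py cod3) => [[h _]|[c h]|h|[u [v [uv AF h]]]] cGy.
  - by move: f67 gb Qy h cGy; clear; lia.
  - by have := Q6 c f6; have := p3 c; move: f67 gb Qy h cGy; clear; lia.
  - by move: f67 gb Qy h cGy; clear; lia.
  - have [c2|c3] := leqP #|through2 G u v| 2.
      by move: f67 gb Qy h cGy c2; clear; lia.
    have {}c3 : #|through2 G u v| = 3 by apply/eqP; rewrite eqn_leq cod3.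
    have := card_codeg3 FG uv c3; have : 0 < #|through2 F u v|.
      by apply/card_gt0P; exists [set y; u; v]; rewrite inE AF !mem_set3 !eqxx !orbT.
    by have := p3 u; have := p3 v; rewrite c3 in h; move: f67 gb Qy h cGy; clear; lia.
(* Codegree 3 gives |F| <= p u + p v + 1: at most 5 when |F| is 6 or 7 by [no3], and at most 7 in
   general. *)
have cod2 : 5 < #|F| -> forall u v, u != v -> #|through2 G u v| <= 2.
  move=> f6 u v uv; rewrite leqNgt; apply/negP => c3.
  have {}c3 : #|through2 G u v| = 3 by apply/eqP; rewrite eqn_leq cod3.
  have h := card_codeg3 FG uv c3; have [f7|f8] := leqP #|F| 7.
    by have := no3 f6 f7 u; have := no3 f6 f7 v; move: h f6; clear; lia.
  by have := p3 u; have := p3 v; move: h f8; clear; lia.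
have cGx := cG x; have le9x := le9 x; have p3x := p3 x; have cFx := cF x.
have Qx := Q x; have q9x := q9 x.
(* Here [x] has degree at least 7 in [G], hence 2 or 3 in [F]. At most 12 or 10 edges of [G] can
   miss it, while at least 14 or 12 do. *)
have [f5|f6] := leqP #|F| 5.
  have gb : #|F| = 4 /\ 26 <= #|G| \/ #|F| = 5 /\ 21 <= #|G|.
    have [E|E] : #|F| = 4 \/ #|F| = 5 by move: f4 f5; clear; lia.
      by left; move: big; rewrite E; clear; lia.
    by right; move: big; rewrite E; clear; lia.
  have q7 : 6 < #|through G x| by move: gb xh; clear; lia.
  have {}Qx := Qx (ltnW (ltnW (ltnW q7))).
  have [p2|p3'] : #|through F x| = 2 \/ #|through F x| = 3.
  - by move: Qx q9x gb xh p3x le9x; clear; lia.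
  - case: (missing_deg2 FG p2 cod3) => [h|[c h]]; last have := le9 c;
      by move: Qx q9x gb xh p2 le9x h cGx; clear; lia.
  case: (missing_deg3 FG p3 p3' cod3) => [[h _]|[c h]|h|[u [v [uv _ h]]]].
  - by move: Qx q9x gb xh p3' le9x h cGx; clear; lia.
  - by have := le9 c; move: Qx q9x gb xh p3' le9x h cGx; clear; lia.
  - by move: Qx q9x gb xh p3' le9x h cGx; clear; lia.
  - by have := cod3 u v uv; move: Qx q9x gb xh p3' le9x h cGx; clear; lia.
have q6 c := Q6 c f6; have q6x := q6 x; have {}cod2 := cod2 f6.
have [f7|f8] := leqP #|F| 7.
  have {}no3 := no3 f6 f7; have no3x := no3 x.
  have gb : #|F| = 6 /\ 17 <= #|G| \/ #|F| = 7 /\ 15 <= #|G|.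
    have [E|E] : #|F| = 6 \/ #|F| = 7 by move: f6 f7; clear; lia.
      by left; move: big; rewrite E; clear; lia.
    by right; move: big; rewrite E; clear; lia.
  (* With [k = 2] at most eight edges of [G] miss [x], while at least ten must. *)
  have p2 : #|through F x| = 2 by move: q6x no3x gb xh; clear; lia.
  case: (missing_deg2 FG p2 cod2) => [h|[c h]]; last have := q6 c; last have := no3 c;
    by move: q6x no3x gb xh p2 h cGx; clear; lia.
have gb : #|F| = 8 /\ 13 <= #|G| \/ #|F| = 9 /\ 12 <= #|G|.
  have [E|E] : #|F| = 8 \/ #|F| = 9 by move: f8 F9; clear; lia.
    by left; move: big; rewrite E; clear; lia.
  by right; move: big; rewrite E; clear; lia.
(* At least eight edges of [G] and five of [F] miss [x]. With [k = 2] only a matching admits more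
   than six covers, and [matching_link_small] then contradicts the degree of [x] in [G]. *)
have px : #|through F x| = 3 by move: q6x p3x gb xh; clear; lia.
case: (missing_deg3 FG p3 px cod2) => [[h1 h2]|[c h]|h|[u [v [uv _ h]]]].
- have : #|through G x| <= 1.
    by apply: h2; [move: q6x gb px xh cGx | move: gb px cFx]; clear; lia.
  by move: gb xh; clear; lia.
- by have := q6 c; have := p3 c; move: q6x gb px xh cGx h; clear; lia.
- by move: q6x gb px xh cGx h; clear; lia.
- by have := cod2 u v uv; move: q6x gb px xh cGx h; clear; lia.
Qed.

Lemma card_mul_le100 F G : cross_pair F G -> [disjoint F & G] -> #|F| * #|G| <= 100.
Proof.
move=> FG dFG; rewrite leqNgt; apply/negP => big.
have main F' G' : cross_pair F' G' -> [disjoint F' & G'] -> 100 < #|F'| * #|G'| ->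
    #|F'| <= #|G'| -> False.
  move=> FG' d' big' le'; have [F9 p3 Q] := degrees_le3 FG' d' big' le'.
  apply: (degrees_le3_absurd FG' big' F9 p3 _ Q) => x /(through_nine FG' d')[f2 _].
  by rewrite (card_through_missing F' x) f2.
have [leFG|/ltnW leGF] := leqP #|F| #|G|; first exact: main leFG.
by apply: (main G F); rewrite 1?disjoint_sym 1?mulnC //; apply: cross_pairC.
Qed.

End Degrees.

(** * The theorem and the extremal example *)

Lemma cross_pair_of_covering (T : finType) (F G : {set {set T}}) :
  is_3graph F -> is_3graph G -> cross_intersecting F G ->
  covering_number F = 3 -> covering_number G = 3 -> cross_pair F G.
Proof.
move=> F3 G3 /forall_inP FG tF tG.
have tau (H : {set {set T}}) : is_3graph H -> covering_number H = 3 ->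
    forall S : {set T}, #|S| <= 2 -> exists2 A, A \in H & [disjoint S & A].
  move=> H3 /(covering_numberP _ H3)[_ Hmin] S S2.
  have : ~~ hitting_set H S by apply: contraL S2 => /Hmin; rewrite -ltnNge.
  by rewrite negb_forall_in => /exists_inP[A AH]; rewrite negbK setI_eq0; exists A.
split; [by move=> A /(forall_inP F3)/eqP|by move=> A /(forall_inP G3)/eqP| |exact: tau|exact: tau].
by move=> A B /FG/forall_inP AB /AB/set0Pn[z]; rewrite inE => /andP[]; exists z.
Qed.

(** * Families of triples of a 6-element set *)

Definition subset6 (t : seq nat) : {set 'I_6} := [set i : 'I_6 | val i \in t].
Definition family6 (ts : seq (seq nat)) : {set {set 'I_6}} := [set A in map subset6 ts].

(* The triples containing 0 are the [0; i; j] with [ij] an edge of the pentagon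
   1-2-3-4-5, and the others are their complements; for [pentagram_triples],
   [ij] is a diagonal of the pentagon. *)
Definition pentagon_triples :=
  [:: [:: 0; 1; 2]; [:: 0; 2; 3]; [:: 0; 3; 4]; [:: 0; 4; 5]; [:: 0; 1; 5];
      [:: 3; 4; 5]; [:: 1; 4; 5]; [:: 1; 2; 5]; [:: 1; 2; 3]; [:: 2; 3; 4]].
Definition pentagram_triples :=
  [:: [:: 0; 1; 3]; [:: 0; 2; 4]; [:: 0; 3; 5]; [:: 0; 1; 4]; [:: 0; 2; 5];
      [:: 2; 4; 5]; [:: 1; 3; 5]; [:: 1; 2; 4]; [:: 2; 3; 5]; [:: 1; 3; 4]].

(** Increasing lists represent triples uniquely, so that questions about sets become computations on
    lists. *)
Definition sorted_triple (t : seq nat) := (size t == 3) && (t == [seq i <- iota 0 6 | i \in t]).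

Lemma subset6_inj : {in sorted_triple &, injective subset6}.
Proof.
move=> t u /andP[_ /eqP tE] /andP[_ /eqP uE] /setP tu; rewrite tE uE.
apply: eq_in_filter => i; rewrite mem_iota => i6; have := tu (Ordinal i6).
by rewrite !inE.
Qed.

Lemma card_subset6 t : sorted_triple t -> #|subset6 t| = 3.
Proof.
case/andP=> /eqP t3 /eqP tE; rewrite -[RHS]t3 [in RHS]tE size_filter -sum1_count.
by rewrite -[iota 0 6]/(index_iota 0 6) big_mkord -sum1dep_card.
Qed.

Lemma family6P (ts : seq (seq nat)) A : reflect (exists2 t, t \in ts & A = subset6 t) (A \in family6 ts).
Proof. by rewrite inE; apply: (iffP mapP). Qed.

Lemma card_family6 ts : all sorted_triple ts -> uniq ts -> #|family6 ts| = size ts.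
Proof.
move=> /allP st ut; rewrite cardsE -(size_map subset6); apply/card_uniqP.
by rewrite map_inj_in_uniq // => t u /st ? /st; apply: subset6_inj.
Qed.

Lemma is_3graph_family6 ts : all sorted_triple ts -> is_3graph (family6 ts).
Proof.
move=> /allP st; apply/forall_inP => A /family6P[t /st tT ->].
by rewrite card_subset6.
Qed.

Lemma disjoint_family6 ts us : all sorted_triple ts -> all sorted_triple us ->
  all (fun t => t \notin us) ts -> [disjoint family6 ts & family6 us].
Proof.
move=> /allP sts /allP sus /allP tu; rewrite disjoint_subset.
apply/subsetP => A /family6P[t tT ->]; apply/negP => /family6P[u uU /subset6_inj E].
by have := tu t tT; rewrite (E (sts t tT) (sus u uU)) uU.
Qed.

Lemma cross_family6 ts us : all sorted_triple us ->
  all (fun t => all (fun u => has (mem t) u) us) ts -> cross_intersecting (family6 ts) (family6 us).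
Proof.
move=> /allP sus /allP h; apply/forall_inP => A /family6P[t /h/allP ht ->].
apply/forall_inP => B /family6P[u uU ->]; have /hasP[i iu it] := ht u uU.
have i6 : i < 6.
  by move: iu; have /andP[_ /eqP ->] := sus u uU; rewrite mem_filter mem_iota => /andP[].
by apply/set0Pn; exists (Ordinal i6); rewrite !inE iu andbT.
Qed.

(** Any triple of the other family is a hitting set of size 3. The computed condition on pairs, with
    [i = j] allowed, excludes all smaller ones. *)
Lemma covering_family6 ts us : all sorted_triple ts -> all sorted_triple us -> us != [::] ->
  cross_intersecting (family6 ts) (family6 us) ->
  all (fun i => all (fun j => has (fun t => (i \notin t) && (j \notin t)) ts) (iota 0 6)) (iota 0 6) ->
  covering_number (family6 ts) = 3.
Proof.
move=> sts sus us0 /forall_inP ht /allP h; apply/(covering_numberP _ (is_3graph_family6 sts)); split.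
  case: us us0 sus ht => // u us _ /andP[su _] ht; exists (subset6 u); last exact: card_subset6.
  apply/forall_inP => A /ht/forall_inP; rewrite setIC; apply.
  by apply/family6P; exists u; rewrite // mem_head.
move=> C /forall_inP hC; rewrite leqNgt; apply/negP => C2.
have [a [b Cab]] : exists a b, C \subset [set a; b].
  case E: #|C| C2 => [|[|[|//]]] _.
  - by exists ord0, ord0; rewrite (cards0_eq E) sub0set.
  - by have /eqP/cards1P[a ->] := E; exists a, a; rewrite setUid.
  - by have /eqP/cards2P[a [b [_ ->]]] := E; exists a, b.
have io (i : 'I_6) : val i \in iota 0 6 by rewrite mem_iota ltn_ord.
have /allP/(_ _ (io b))/hasP[t tT /andP[at_ bt]] := h _ (io a).
have /set0Pn[z] := hC (subset6 t) (introT (family6P ts _) (ex_intro2 _ _ t tT erefl)).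
rewrite inE => /andP[/(subsetP Cab)]; rewrite !inE.
by case/orP=> /eqP ->; apply/negP.
Qed.

Theorem theorem1p1 :
  (forall (T : finType) (F G : {set {set T}}),
     is_3graph F -> is_3graph G ->
     [disjoint F & G] -> cross_intersecting F G ->
     covering_number F = 3 -> covering_number G = 3 ->
     #|F| * #|G| <= 100) /\
  (exists (T : finType) (F G : {set {set T}}),
     [/\ is_3graph F, is_3graph G, [disjoint F & G] & cross_intersecting F G] /\
     [/\ covering_number F = 3, covering_number G = 3 & #|F| * #|G| = 100]).
Proof.
split=> [T F G F3 G3 dFG FG tF tG|].
  exact: card_mul_le100 (cross_pair_of_covering F3 G3 FG tF tG) dFG.
have sF : all sorted_triple pentagon_triples by [].
have sG : all sorted_triple pentagram_triples by [].
(* Triples of a 6-element set are disjoint only if complementary, and both families are closed under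
   complements; together they consist of all 20 triples. *)
have FG : cross_intersecting (family6 pentagon_triples) (family6 pentagram_triples).
  exact: cross_family6.
have GF : cross_intersecting (family6 pentagram_triples) (family6 pentagon_triples).
  exact: cross_family6.
exists 'I_6, (family6 pentagon_triples), (family6 pentagram_triples).
split; split; rewrite ?is_3graph_family6 ?disjoint_family6 //.
- exact: covering_family6 sF sG _ FG _.
- exact: covering_family6 sG sF _ GF _.
- by rewrite !card_family6.
Qed.
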